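(* Let $m,n\ge 1$, let $\mathrm{Z}=\mathrm{Z}(\mathfrak{gl}(m+n),\mathfrak{gl}(m))$ be the transvector algebra and $\psi:\mathrm{Y}(n)\to \mathrm{Z}$ the composition of the homomorphism $\phi:\mathrm{Y}(n)\to \mathrm{U}(\mathfrak{gl}(m+n))^{\mathfrak{gl}(m)}$ with the natural homomorphism $\nu:\mathrm{U}(\mathfrak{gl}(m+n))^{\mathfrak{gl}(m)}\to \mathrm{Z}$ (all defined in the context). For $a,b\in\{m+1,\dots,m+n\}$ put $$T_{ab}(u)=u(u-1)\cdots(u-m)\,t_{a-m,\,b-m}(u).$$ Then for all $a,b=m+1,\dots,m+n$, in $\mathrm{Z}[u]$, $$\psi:T_{ab}(u)\mapsto \bigl(\delta_{ab}(u-m)+E_{ab}\bigr)\prod_{i=1}^m(u+h_i)-\sum_{i=1}^m s_{ai}s_{ib}\prod_{j=1,\,j\ne i}^m\frac{u+h_j}{h_i-h_j}$$ and $$\psi:T_{ab}(u)\mapsto \bigl(\delta_{ab}u+E_{ab}\bigr)\prod_{i=1}^m(u+h_i-1)-\sum_{i=1}^m s_{ib}s_{ai}\prod_{j=1,\,j\ne i}^m\frac{u+h_j-1}{h_i-h_j}.$$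
   Context: Yangian: $\mathrm{Y}(n)$ is the complex unital associative algebra with generators $t_{ij}^{(r)}$, $r\ge1$, $1\le i,j\le n$, and defining relations $[t_{ij}(u),t_{kl}(v)]=\frac{1}{u-v}(t_{kj}(u)t_{il}(v)-t_{kj}(v)t_{il}(u))$, where $t_{ij}(u)=\delta_{ij}+\sum_{r\ge1}t_{ij}^{(r)}u^{-r}$. Lie algebras: $E_{ij}$ ($1\le i,j\le m+n$) is the standard basis of $\mathfrak{gl}(m+n)$ over $\mathbb{C}$; $\mathfrak{gl}(m)\subset\mathfrak{gl}(m+n)$ is spanned by $E_{ij}$ with $1\le i,j\le m$; $\mathfrak{h}=\mathrm{span}\{E_{11},\dots,E_{mm}\}$; $h_i=E_{ii}-i+1$ for $1\le i\le m$. Transvector algebra: let $\mathrm{R}(\mathfrak{h})$ be the field of fractions of $\mathrm{U}(\mathfrak{h})$ and $\mathrm{A}'(m+n)=\mathrm{U}(\mathfrak{gl}(m+n))\otimes_{\mathrm{U}(\mathfrak{h})}\mathrm{R}(\mathfrak{h})$ (the localization of the enveloping algebra at nonzero elements of $\mathrm{U}(\mathfrak{h})$). Let $\mathrm{J}$ be the left ideal of $\mathrm{A}'(m+n)$ generated by $E_{ij}$, $1\le i<j\le m$, and $\mathrm{Norm}\,\mathrm{J}=\{x\in \mathrm{A}'(m+n): \mathrm{J}x\subseteq \mathrm{J}\}$. Then $\mathrm{Z}=\mathrm{Norm}\,\mathrm{J}/\mathrm{J}$, an algebra over $\mathbb{C}$ and an $\mathrm{R}(\mathfrak{h})$-bimodule.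 The centralizer $\mathrm{U}(\mathfrak{gl}(m+n))^{\mathfrak{gl}(m)}$ is contained in $\mathrm{Norm}\,\mathrm{J}$, which gives the natural homomorphism $\nu$ to $\mathrm{Z}$. The elements $E_{ab}$, $a,b>m$, are regarded as elements of $\mathrm{Z}$. Raising and lowering operators: for $1\le i\le m$ and $m+1\le a\le m+n$, $s_{ia},s_{ai}\in \mathrm{Z}$ are the classes modulo $\mathrm{J}$ of $$s_{ia}=\sum_{i>i_1>\cdots>i_s\ge1}E_{ii_1}E_{i_1i_2}\cdots E_{i_{s-1}i_s}E_{i_sa}\,(h_i-h_{j_1})\cdots(h_i-h_{j_r}),$$ $$s_{ai}=\sum_{i<i_1<\cdots<i_s\le m}E_{i_1i}E_{i_2i_1}\cdots E_{i_si_{s-1}}E_{ai_s}\,(h_i-h_{j_1})\cdots(h_i-h_{j_r}),$$ where $s=0,1,\dots$ (for $s=0$ the product of $E$'s is $E_{ia}$, resp. $E_{ai}$) and $\{j_1,\dots,j_r\}$ is the complement of $\{i_1,\dots,i_s\}$ in $\{1,\dots,i-1\}$, resp. in $\{i+1,\dots,m\}$. (Equivalently $s_{ia}=pE_{ia}(h_i-h_1)\cdots(h_i-h_{i-1})$ and $s_{ai}=pE_{ai}(h_i-h_{i+1})\cdots(h_i-h_m)$, where $p$ is the extremal projection for $\mathfrak{gl}(m)$.) Homomorphism $\phi$: for $1\le a,b\le n$, $\phi(t_{ab}(u))=\mathrm{qdet}(1+Eu^{-1})_{{\cal C}_a{\cal C}_b}$ with ${\cal C}_a=\{1,\dots,m,m+a\}$;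 explicitly, with $(c_1,\dots,c_{m+1})=(1,\dots,m,m+a)$ and $(d_1,\dots,d_{m+1})=(1,\dots,m,m+b)$, $$\phi(t_{ab}(u))=\sum_{\sigma\in\mathfrak{S}_{m+1}}\mathrm{sgn}(\sigma)\prod_{r=1,\dots,m+1}^{\rightarrow}\bigl(\delta_{c_{\sigma(r)}d_r}+E_{c_{\sigma(r)}d_r}(u-r+1)^{-1}\bigr),$$ factors being ordered left to right by increasing $r$. This is an algebra homomorphism $\mathrm{Y}(n)\to \mathrm{U}(\mathfrak{gl}(m+n))^{\mathfrak{gl}(m)}$, and the image of $T_{ab}(u)$ is a polynomial in $u$. *)

(* Defs.v *)
From HB Require Import structures.
From mathcomp Require Import all_boot all_order perm all_algebra.
From mathcomp Require Import boolp classical_sets functions fsbigop reals.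
From mathcomp Require Export complex.
From mathcomp Require Import zify.

Set Implicit Arguments.
Unset Strict Implicit.
Unset Printing Implicit Defensive.

Import Order.TTheory GRing.Theory Num.Theory.
Local Open Scope ring_scope.
Local Open Scope quotient_scope.

(** [presented rel] is the unital associative K-algebra generated by X subject
    to the relations [rel]: formal expressions modulo the smallest congruence
    that contains [rel] and the axioms of K-algebras.  Opposites are obtained
    by multiplying by the scalar -1. *)

Inductive term (K X : Type) : Type :=
  | Gen of X
  | Cst of K
  | Add of term K X & term K X
  | Mul of term K X & term K X.

Arguments Gen {K X}.
Arguments Cst {K X}.

HB.instance Definition _ (K X : Type) := gen_eqMixin (term K X).
HB.instance Definition _ (K X : Type) := gen_choiceMixin (term K X).

Section Presented.
Variables (K : fieldType) (X : Type) (rel : term K X -> term K X -> Prop).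

Inductive eqv : term K X -> term K X -> Prop :=
  | eqv_rel s t : rel s t -> eqv s t
  | eqv_refl s : eqv s s
  | eqv_sym s t : eqv s t -> eqv t s
  | eqv_trans s t r : eqv s t -> eqv t r -> eqv s r
  | eqv_Add s s' t t' : eqv s s' -> eqv t t' -> eqv (Add s t) (Add s' t')
  | eqv_Mul s s' t t' : eqv s s' -> eqv t t' -> eqv (Mul s t) (Mul s' t')
  | eqv_addA s t r : eqv (Add s (Add t r)) (Add (Add s t) r)
  | eqv_addC s t : eqv (Add s t) (Add t s)
  | eqv_add0 s : eqv (Add (Cst 0) s) s
  | eqv_addN s : eqv (Add (Mul (Cst (-1)) s) s) (Cst 0)
  | eqv_mulA s t r : eqv (Mul s (Mul t r)) (Mul (Mul s t) r)
  | eqv_mul1l s : eqv (Mul (Cst 1) s) s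
  | eqv_mul1r s : eqv (Mul s (Cst 1)) s
  | eqv_mulDl s t r : eqv (Mul (Add s t) r) (Add (Mul s r) (Mul t r))
  | eqv_mulDr s t r : eqv (Mul s (Add t r)) (Add (Mul s t) (Mul s r))
  | eqv_CstD a b : eqv (Cst (a + b)) (Add (Cst a) (Cst b))
  | eqv_CstM a b : eqv (Cst (a * b)) (Mul (Cst a) (Cst b))
  | eqv_CstC a s : eqv (Mul (Cst a) s) (Mul s (Cst a)).

Definition eqvb (s t : term K X) : bool := `[< eqv s t >].

Lemma eqvb_equiv : equiv_class_of eqvb.
Proof.
split=> [s|s t|t s r]; first exact/asboolP/eqv_refl.
  by apply/asboolP/asboolP; exact: eqv_sym.
by move=> /asboolP st /asboolP tr; apply/asboolP/(eqv_trans st tr).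
Qed.

Canonical eqvb_rel := EquivRelPack eqvb_equiv.

Definition presented : Type := {eq_quot eqvb_rel}.

HB.instance Definition _ := Choice.on presented.
HB.instance Definition _ := EqQuotient.on presented.

Definition pclass (t : term K X) : presented := \pi_presented t.

Lemma pclassP s t : pclass s = pclass t <-> eqv s t.
Proof.
split=> [/eqmodP/asboolP //|st]; exact/eqmodP/asboolP.
Qed.

Lemma pclass_repr x : pclass (repr x) = x.
Proof. exact: reprK. Qed.

Lemma eqv_repr t : eqv (repr (pclass t)) t.
Proof. by apply/pclassP; rewrite pclass_repr. Qed.

Definition pcst (c : K) : presented := pclass (Cst c).
Definition padd (x y : presented) := pclass (Add (repr x) (repr y)).
Definition pmul (x y : presented) := pclass (Mul (repr x) (repr y)).
Definition popp (x : presented) := pmul (pcst (-1)) x.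

Lemma pclassD s t : pclass (Add s t) = padd (pclass s) (pclass t).
Proof. by apply/pclassP/eqv_Add; apply/eqv_sym/eqv_repr. Qed.

Lemma pclassM s t : pclass (Mul s t) = pmul (pclass s) (pclass t).
Proof. by apply/pclassP/eqv_Mul; apply/eqv_sym/eqv_repr. Qed.

Lemma paddA : associative padd.
Proof.
move=> x y z; rewrite -(pclass_repr x) -(pclass_repr y) -(pclass_repr z).
by rewrite -!pclassD; apply/pclassP/eqv_addA.
Qed.

Lemma paddC : commutative padd.
Proof. by move=> x y; apply/pclassP/eqv_addC. Qed.

Lemma padd0 : left_id (pcst 0) padd.
Proof.
by move=> x; rewrite -(pclass_repr x) -pclassD; apply/pclassP/eqv_add0.
Qed.

Lemma paddN : left_inverse (pcst 0) popp padd.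
Proof.
move=> x; rewrite -(pclass_repr x) /popp -pclassM -pclassD.
exact/pclassP/eqv_addN.
Qed.

HB.instance Definition _ := GRing.isZmodule.Build presented paddA paddC padd0 paddN.

Lemma pmulA : associative pmul.
Proof.
move=> x y z; rewrite -(pclass_repr x) -(pclass_repr y) -(pclass_repr z).
by rewrite -!pclassM; apply/pclassP/eqv_mulA.
Qed.

Lemma pmul1l : left_id (pcst 1) pmul.
Proof.
by move=> x; rewrite -(pclass_repr x) -pclassM; apply/pclassP/eqv_mul1l.
Qed.

Lemma pmul1r : right_id (pcst 1) pmul.
Proof.
by move=> x; rewrite -(pclass_repr x) -pclassM; apply/pclassP/eqv_mul1r.
Qed.

Lemma pmulDl : left_distributive pmul padd.
Proof.
move=> x y z; rewrite -(pclass_repr x) -(pclass_repr y) -(pclass_repr z).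
by rewrite -!(pclassM, pclassD); apply/pclassP/eqv_mulDl.
Qed.

Lemma pmulDr : right_distributive pmul padd.
Proof.
move=> x y z; rewrite -(pclass_repr x) -(pclass_repr y) -(pclass_repr z).
by rewrite -!(pclassM, pclassD); apply/pclassP/eqv_mulDr.
Qed.

HB.instance Definition _ := GRing.Zmodule_isPzRing.Build presented
  pmulA pmul1l pmul1r pmulDl pmulDr.

Definition pscale (c : K) (x : presented) : presented := pcst c * x.

Lemma pcstM a b : pcst (a * b) = pcst a * pcst b.
Proof. by rewrite -[RHS]pclassM; apply/pclassP/eqv_CstM. Qed.

Lemma pcstD a b : pcst (a + b) = pcst a + pcst b.
Proof. by rewrite -[RHS]pclassD; apply/pclassP/eqv_CstD. Qed.

Lemma pcstC a x : pcst a * x = x * pcst a.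
Proof.
by rewrite -(pclass_repr x) -[LHS]pclassM -[RHS]pclassM; apply/pclassP/eqv_CstC.
Qed.

Lemma pscaleA a b x : pscale a (pscale b x) = pscale (a * b) x.
Proof. by rewrite /pscale mulrA pcstM. Qed.

Lemma pscale1 : left_id 1 pscale.
Proof. exact: pmul1l. Qed.

Lemma pscaleDr : right_distributive pscale +%R.
Proof. by move=> a x y; rewrite /pscale mulrDr. Qed.

Lemma pscaleDl x : {morph pscale^~ x : a b / a + b}.
Proof. by move=> a b; rewrite /pscale pcstD mulrDl. Qed.

HB.instance Definition _ := GRing.Zmodule_isLmodule.Build K presented
  pscaleA pscale1 pscaleDr pscaleDl.

Lemma pscaleAl (c : K) (x y : presented) : c *: (x * y) = (c *: x) * y.
Proof. exact: mulrA. Qed.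

Lemma pscaleAr (c : K) (x y : presented) : c *: (x * y) = x * (c *: y).
Proof. by rewrite [RHS]mulrA -pcstC; exact: mulrA. Qed.

Fixpoint aug (t : term K X) : K :=
  match t with
  | Gen _ => 0
  | Cst c => c
  | Add s r => aug s + aug r
  | Mul s r => aug s * aug r
  end.

Lemma presented_neq0 : (forall s t, rel s t -> aug s = aug t) ->
  1 != 0 :> presented.
Proof.
move=> augrel; apply/eqP => /pclassP e; suff: aug (Cst 1) = aug (Cst 0).
  by move/eqP; rewrite oner_eq0.
elim: e => //= {augrel}.
- by move=> s t r _ -> _ ->.
- by move=> s s' t t' _ -> _ ->.
- by move=> s s' t t' _ -> _ ->.
- by move=> *; rewrite addrA.
- by move=> *; rewrite addrC.
- by move=> *; rewrite add0r.
- by move=> *; rewrite mulN1r addNr.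
- by move=> *; rewrite mulrA.
- by move=> *; rewrite mul1r.
- by move=> *; rewrite mulr1.
- by move=> *; rewrite mulrDl.
- by move=> *; rewrite mulrDr.
- by move=> *; rewrite mulrC.
Qed.

End Presented.

Definition Minus (K : fieldType) (X : Type) (s t : term K X) : term K X :=
  Add s (Mul (Cst (-1)) t).

(** [tterm i j r] is the formal generator t_ij^(r) for r >= 1 and delta_ij for
    r = 0; the generator indexed by (i, j, r) is t_ij^(r+1).  The relation is
    the coefficient of u^-r v^-s in
    (u - v) [t_ij(u), t_kl(v)] = t_kj(u) t_il(v) - t_kj(v) t_il(u). *)

Section Yangian.
Variables (K : fieldType) (n : nat).

Definition ygen : Type := ('I_n * 'I_n * nat)%type.

Definition tterm (i j : 'I_n) (r : nat) : term K ygen :=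
  if r is r'.+1 then Gen (i, j, r') else Cst (i == j)%:R.

Definition comm_term (s t : term K ygen) := Minus (Mul s t) (Mul t s).

Inductive yrel : term K ygen -> term K ygen -> Prop :=
  | YRel i j k l r s :
      yrel (Minus (comm_term (tterm i j r.+1) (tterm k l s))
                (comm_term (tterm i j r) (tterm k l s.+1)))
           (Minus (Mul (tterm k j r) (tterm i l s))
                (Mul (tterm k j s) (tterm i l r))).

Definition yangian : Type := presented yrel.

HB.instance Definition _ := GRing.PzRing.on yangian.
HB.instance Definition _ := GRing.Lmodule.on yangian.

Lemma yangian_neq0 : 1 != 0 :> yangian.
Proof.
by apply: presented_neq0 => _ _ [i j k l [|r] [|s]] /=;
  rewrite ?(mul0r, mulr0, addr0, mulN1r, subrr, oppr0).
Qed.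

HB.instance Definition _ := GRing.PzSemiRing_isNonZero.Build yangian yangian_neq0.
HB.instance Definition _ :=
  GRing.Lmodule_isLalgebra.Build K yangian (@pscaleAl K ygen yrel).
HB.instance Definition _ :=
  GRing.Lalgebra_isAlgebra.Build K yangian (@pscaleAr K ygen yrel).

Definition tgen (i j : 'I_n) (r : nat) : yangian := pclass yrel (tterm i j r).

End Yangian.

Section Envelop.
Variables (K : fieldType) (N : nat).

Inductive glrel : term K 'M[K]_N -> term K 'M[K]_N -> Prop :=
  | glrelD (A B : 'M[K]_N) : glrel (Gen (A + B)) (Add (Gen A) (Gen B))
  | glrelZ (c : K) (A : 'M[K]_N) : glrel (Gen (c *: A)) (Mul (Cst c) (Gen A))
  | glrelM (A B : 'M[K]_N) :
      glrel (Gen (A *m B - B *m A))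
            (Minus (Mul (Gen A) (Gen B)) (Mul (Gen B) (Gen A))).

Definition Ugl : Type := presented glrel.

HB.instance Definition _ := GRing.PzRing.on Ugl.
HB.instance Definition _ := GRing.Lmodule.on Ugl.

Lemma Ugl_neq0 : 1 != 0 :> Ugl.
Proof.
by apply: presented_neq0 => _ _ [A B|c A|A B] /=;
  rewrite ?(mul0r, mulr0, addr0).
Qed.

HB.instance Definition _ := GRing.PzSemiRing_isNonZero.Build Ugl Ugl_neq0.
HB.instance Definition _ :=
  GRing.Lmodule_isLalgebra.Build K Ugl (@pscaleAl K _ glrel).
HB.instance Definition _ :=
  GRing.Lalgebra_isAlgebra.Build K Ugl (@pscaleAr K _ glrel).

Definition E (i j : 'I_N) : Ugl := pclass glrel (Gen (delta_mx i j)).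

End Envelop.

(** The universal algebra under A in which the elements of S become
    invertible.  For an Ore set S, such as the nonzero elements of U(h) in
    U(gl(m+n)), it is the Ore localization U(gl(m+n)) (x)_U(h) R(h). *)

Section Localization.
Variables (K : fieldType) (A : algType K) (S : A -> Prop).

Definition lgen : Type := (A + {s : A | S s})%type.

Inductive locrel : term K lgen -> term K lgen -> Prop :=
  | locrelD (a b : A) :
      locrel (Gen (inl (a + b))) (Add (Gen (inl a)) (Gen (inl b)))
  | locrelM (a b : A) :
      locrel (Gen (inl (a * b))) (Mul (Gen (inl a)) (Gen (inl b)))
  | locrelC (c : K) : locrel (Gen (inl c%:A)) (Cst c)
  | locrelVr (s : {s : A | S s}) :
      locrel (Mul (Gen (inl (sval s))) (Gen (inr s))) (Cst 1)
  | locrelVl (s : {s : A | S s}) :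
      locrel (Mul (Gen (inr s)) (Gen (inl (sval s)))) (Cst 1).

Definition localization : Type := presented locrel.

HB.instance Definition _ := GRing.PzRing.on localization.
HB.instance Definition _ := GRing.Lmodule.on localization.

Definition loc (a : A) : localization := pclass locrel (Gen (inl a)).

Lemma loc_is_zmod_morphism : zmod_morphism loc.
Proof.
have locD a b : loc (a + b) = loc a + loc b.
  by rewrite -[RHS]pclassD; apply/pclassP/eqv_rel/locrelD.
by move=> a b; apply: (addIr (loc b)); rewrite -locD !subrK.
Qed.

Lemma loc_is_monoid_morphism : monoid_morphism loc.
Proof.
split=> [|a b]; last by rewrite -[RHS]pclassM; apply/pclassP/eqv_rel/locrelM.
by rewrite -[1]scale1r; apply/pclassP/eqv_rel/locrelC.
Qed.

Lemma loc_is_scalable : scalable loc.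
Proof.
move=> c a; rewrite -mulr_algl (loc_is_monoid_morphism).2; congr (_ * _).
exact/pclassP/eqv_rel/locrelC.
Qed.

HB.instance Definition _ :=
  GRing.isZmodMorphism.Build A localization loc loc_is_zmod_morphism.
HB.instance Definition _ :=
  GRing.isMonoidMorphism.Build A localization loc loc_is_monoid_morphism.
HB.instance Definition _ :=
  GRing.isScalable.Build K A localization *:%R loc loc_is_scalable.

End Localization.

(** Total inverse: 0 if x is not invertible. *)
Definition rinv (A : pzRingType) (x : A) : A :=
  xget 0 [set y | x * y = 1 /\ y * x = 1]%classic.

Lemma rinvE (A : pzRingType) (x y : A) : x * y = 1 -> y * x = 1 -> rinv x = y.
Proof.
move=> xy yx; rewrite /rinv; case: xgetP => [z _ [xz zx]|/(_ y)]; last by case.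
by rewrite -[z]mulr1 -xy mulrA zx mul1r.
Qed.

Section NormQuotient.
Variables (A : pzRingType) (I : finType) (P : pred I) (g : I -> A).

Definition lideal : {pred A} :=
  fun x => `[< exists c : I -> A, x = \sum_(i | P i) c i * g i >].

Definition Norm : {pred A} :=
  fun x => `[< forall y, y \in lideal -> y * x \in lideal >].

Lemma lidealP x :
  reflect (exists c : I -> A, x = \sum_(i | P i) c i * g i) (x \in lideal).
Proof. exact: asboolP. Qed.

Lemma normP x :
  reflect (forall y, y \in lideal -> y * x \in lideal) (x \in Norm).
Proof. exact: asboolP. Qed.

Lemma lideal_zmod_closed : zmod_closed lideal.
Proof.
split=> [|x y /lidealP[c ->] /lidealP[d ->]]; apply/lidealP.
  by exists (fun=> 0); rewrite big1 // => i _; rewrite mul0r.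
exists (fun i => c i - d i); rewrite -sumrB.
by apply: eq_bigr => i _; rewrite mulrBl.
Qed.

HB.instance Definition _ := GRing.isZmodClosed.Build A lideal lideal_zmod_closed.

Lemma lidealMl a x : x \in lideal -> a * x \in lideal.
Proof.
move=> /lidealP[c ->]; apply/lidealP; exists (fun i => a * c i).
by rewrite mulr_sumr; apply: eq_bigr => i _; rewrite mulrA.
Qed.

Lemma norm_subring_closed : subring_closed Norm.
Proof.
split=> [|x y /normP Nx /normP Ny|x y /normP Nx /normP Ny]; apply/normP => z Jz.
- by rewrite mulr1.
- by rewrite mulrBr rpredB ?Nx ?Ny.
- by rewrite mulrA; apply/Ny/Nx.
Qed.

HB.instance Definition _ := GRing.isSubringClosed.Build A Norm norm_subring_closed.

Record normT : Type := NormT { normT_val : A; _ : normT_val \in Norm }.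

HB.instance Definition _ := [isSub for normT_val].
HB.instance Definition _ := [Choice of normT by <:].
HB.instance Definition _ :=
  GRing.SubChoice_isSubPzRing.Build A Norm normT norm_subring_closed.

Definition nideal : {pred normT} := fun x => val x \in lideal.

Lemma nideal_zmod_closed : zmod_closed nideal.
Proof.
split=> [|x y Jx Jy]; first by rewrite unfold_in raddf0 rpred0.
by rewrite unfold_in raddfB rpredB.
Qed.

HB.instance Definition _ := GRing.isZmodClosed.Build normT nideal nideal_zmod_closed.

Lemma nidealMl a x : x \in nideal -> a * x \in nideal.
Proof. by rewrite !unfold_in rmorphM; exact: lidealMl. Qed.

Lemma nidealMr a x : x \in nideal -> x * a \in nideal.
Proof. by rewrite !unfold_in rmorphM => /(normP _ (valP a)). Qed.

Definition normquot : Type := Quotient.quot nideal.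

HB.instance Definition _ := GRing.Zmodule.on normquot.
HB.instance Definition _ := Quotient.on normquot.

Definition nq_pi (x : normT) : normquot := \pi_normquot x.

Lemma nq_piP x y : nq_pi x = nq_pi y <-> x - y \in nideal.
Proof.
by split=> [/eqP|h]; last apply/eqP; rewrite -Quotient.idealrBE.
Qed.

Lemma nq_piD x y : nq_pi (x + y) = nq_pi x + nq_pi y.
Proof. by rewrite /nq_pi Quotient.pi_add. Qed.

Definition nq_mul (x y : normquot) : normquot := nq_pi (repr x * repr y).

Lemma nq_repr x : nq_pi (repr x) = x.
Proof. exact: reprK. Qed.

Lemma nq_piM x y : nq_pi (x * y) = nq_mul (nq_pi x) (nq_pi y).
Proof.
rewrite /nq_mul; set x' := repr _; set y' := repr _; apply/nq_piP.
have Jx : x - x' \in nideal by apply/nq_piP; rewrite nq_repr.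
have Jy : y - y' \in nideal by apply/nq_piP; rewrite nq_repr.
have -> : x * y - x' * y' = (x - x') * y + x' * (y - y').
  by rewrite mulrBl mulrBr addrA subrK.
by apply: rpredD; [exact: nidealMr | exact: nidealMl].
Qed.

Lemma nq_mulA : associative nq_mul.
Proof.
move=> x y z; rewrite -(nq_repr x) -(nq_repr y) -(nq_repr z) -!nq_piM.
by rewrite mulrA.
Qed.

Lemma nq_mul1l : left_id (nq_pi 1) nq_mul.
Proof. by move=> x; rewrite -(nq_repr x) -nq_piM mul1r. Qed.

Lemma nq_mul1r : right_id (nq_pi 1) nq_mul.
Proof. by move=> x; rewrite -(nq_repr x) -nq_piM mulr1. Qed.

Lemma nq_mulDl : left_distributive nq_mul +%R.
Proof.
move=> x y z; rewrite -(nq_repr x) -(nq_repr y) -(nq_repr z).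
by rewrite -!(nq_piD, nq_piM) mulrDl.
Qed.

Lemma nq_mulDr : right_distributive nq_mul +%R.
Proof.
move=> x y z; rewrite -(nq_repr x) -(nq_repr y) -(nq_repr z).
by rewrite -!(nq_piD, nq_piM) mulrDr.
Qed.

HB.instance Definition _ := GRing.Zmodule_isPzRing.Build normquot
  nq_mulA nq_mul1l nq_mul1r nq_mulDl nq_mulDr.

Lemma nq_pi_is_zmod_morphism : zmod_morphism nq_pi.
Proof.
by move=> x y; apply: (addIr (nq_pi y)); rewrite -nq_piD !subrK.
Qed.

Lemma nq_pi_is_monoid_morphism : monoid_morphism nq_pi.
Proof. by split=> // x y; exact: nq_piM. Qed.

HB.instance Definition _ :=
  GRing.isZmodMorphism.Build normT normquot nq_pi nq_pi_is_zmod_morphism.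
HB.instance Definition _ :=
  GRing.isMonoidMorphism.Build normT normquot nq_pi nq_pi_is_monoid_morphism.

(** Total class map: the class modulo J on Norm J, and 0 outside Norm J. *)
Definition ncls (x : A) : normquot := nq_pi (insubd (0 : normT) x).

Lemma nclsE x (Nx : x \in Norm) : ncls x = nq_pi (NormT Nx).
Proof. by congr nq_pi; apply: val_inj; rewrite insubdK. Qed.

End NormQuotient.

(** Laurent series in u^-1: [lcoef f k] is the coefficient of u^k. *)

Section Laurent.
Variable R : pzRingType.

Record laurent : Type := Laurent {
  lcoef : int -> R;
  _ : exists N : int, forall k, N < k -> lcoef k = 0
}.

HB.instance Definition _ := gen_eqMixin laurent.
HB.instance Definition _ := gen_choiceMixin laurent.

Lemma lcoef_bound f : exists N : int, forall k, N < k -> lcoef f k = 0.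
Proof. by case: f. Qed.

Lemma laurentP f g : (forall k, lcoef f k = lcoef g k) -> f = g.
Proof.
case: f g => [f Bf] [g Bg] /= /funext fg; rewrite fg in Bf *.
by rewrite (Prop_irrelevance Bf Bg).
Qed.

Lemma ladd_bound f g :
  exists N : int, forall k, N < k -> lcoef f k + lcoef g k = 0.
Proof.
have [[N fN] [M gM]] := (lcoef_bound f, lcoef_bound g).
exists (Num.max N M) => k; rewrite gt_max => /andP[/fN -> /gM ->].
exact: addr0.
Qed.

Definition ladd f g := Laurent (ladd_bound f g).

Lemma lopp_bound f : exists N : int, forall k, N < k -> - lcoef f k = 0.
Proof.
by have [N fN] := lcoef_bound f; exists N => k /fN ->; rewrite oppr0.
Qed.

Definition lopp f := Laurent (lopp_bound f).

Lemma lconst_bound (c : R) :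
  exists N : int, forall k : int, N < k -> (if k == 0 then c else 0) = 0.
Proof. by exists 0 => k; case: eqP => // ->; rewrite ltxx. Qed.

Definition lconst c := Laurent (lconst_bound c).

Lemma laddA : associative ladd.
Proof. by move=> f g h; apply: laurentP => k /=; rewrite addrA. Qed.

Lemma laddC : commutative ladd.
Proof. by move=> f g; apply: laurentP => k /=; rewrite addrC. Qed.

Lemma ladd0 : left_id (lconst 0) ladd.
Proof. by move=> f; apply: laurentP => k /=; rewrite if_same add0r. Qed.

Lemma laddN : left_inverse (lconst 0) lopp ladd.
Proof. by move=> f; apply: laurentP => k /=; rewrite if_same addNr. Qed.

HB.instance Definition _ := GRing.isZmodule.Build laurent laddA laddC ladd0 laddN.

Definition conv (f g : int -> R) (k : int) : R :=
  \sum_(i \in [set: int]%classic) f i * g (k - i).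

Lemma convE (f g : int -> R) k (s : seq int) : uniq s ->
  (forall i, i \notin s -> f i * g (k - i) = 0) ->
  conv f g k = \sum_(i <- s) f i * g (k - i).
Proof.
move=> us s0; rewrite /conv (fsbigE s) //; last by move=> i _; exact: s0.
by under eq_bigl do rewrite in_setT.
Qed.

Definition irange (N : int) (D : nat) : seq int :=
  [seq N - d%:Z | d <- iota 0 D].

Lemma irange_uniq N D : uniq (irange N D).
Proof. by rewrite map_inj_uniq ?iota_uniq // => x y; lia. Qed.

Lemma mem_irange N D i : (i \in irange N D) = (N - D%:Z < i <= N).
Proof.
apply/mapP/idP => [[d]|iN]; first by rewrite mem_iota => + ->; lia.
by exists (absz (N - i)%R); rewrite ?mem_iota; lia.
Qed.

Lemma conv_bound f g :
  exists N : int, forall k, N < k -> conv (lcoef f) (lcoef g) k = 0.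
Proof.
have [[N fN] [M gM]] := (lcoef_bound f, lcoef_bound g).
exists (N + M) => k NMk; rewrite (@convE _ _ _ [::]) ?big_nil // => i _.
have [Ni|iN] := ltP N i; first by rewrite fN ?mul0r.
by rewrite gM ?mulr0 //; lia.
Qed.

Definition lmul f g := Laurent (conv_bound f g).

Lemma lmulA : associative lmul.
Proof.
move=> f g h; apply: laurentP => k /=.
have [a fa] := lcoef_bound f; have [b gb] := lcoef_bound g.
have [c hc] := lcoef_bound h.
have fg0 l : a + b < l -> conv (lcoef f) (lcoef g) l = 0.
  move=> abl; rewrite (@convE _ _ _ [::]) ?big_nil // => i _.
  have [ai|ia] := ltP a i; first by rewrite fa ?mul0r.
  by rewrite gb ?mulr0 //; lia.
have gh0 l : b + c < l -> conv (lcoef g) (lcoef h) l = 0.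
  move=> bcl; rewrite (@convE _ _ _ [::]) ?big_nil // => i _.
  have [bi|ib] := ltP b i; first by rewrite gb ?mul0r.
  by rewrite hc ?mulr0 //; lia.
pose D := (absz (a + b + c - k)%R).+1.
rewrite (@convE _ _ _ (irange a D)) ?irange_uniq //; last first.
  move=> i; rewrite mem_irange => iS.
  have [ai|ia] := ltP a i; first by rewrite fa ?mul0r.
  by rewrite gh0 ?mulr0 //; lia.
rewrite (@convE _ _ _ (irange (a + b) D)) ?irange_uniq //; last first.
  move=> i; rewrite mem_irange => iS.
  have [ai|ia] := ltP (a + b) i; first by rewrite fg0 ?mul0r.
  by rewrite hc ?mulr0 //; lia.
transitivity (\sum_(i <- irange a D) \sum_(l <- irange (a + b) D)
    lcoef f i * lcoef g (l - i) * lcoef h (k - l)); last first.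
  rewrite exchange_big /= !big_seq; apply: eq_bigr => l.
  rewrite mem_irange => lS; rewrite -mulr_suml; congr (_ * _).
  rewrite (@convE _ _ _ (irange a D)) ?irange_uniq // => i.
  rewrite mem_irange => iS.
  have [ai|ia] := ltP a i; first by rewrite fa ?mul0r.
  by rewrite gb ?mulr0 //; lia.
rewrite !big_seq; apply: eq_bigr => i; rewrite mem_irange => iS.
rewrite (@convE _ _ _ [seq l - i | l <- irange (a + b) D]).
- rewrite big_map mulr_sumr; apply: eq_bigr => l _; rewrite mulrA.
  by congr (_ * lcoef h _); lia.
- by rewrite map_inj_uniq ?irange_uniq // => x y; lia.
- move=> j jS; have : j + i \notin irange (a + b) D.
    by apply: contra jS => jS; apply/mapP; exists (j + i) => //; lia.
  rewrite mem_irange => {}jS.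
  have [bj|jb] := ltP b j; first by rewrite gb ?mul0r.
  by rewrite hc ?mulr0 //; lia.
Qed.

Lemma lcoef_const_mul (c : R) f k : conv (lcoef (lconst c)) (lcoef f) k = c * lcoef f k.
Proof.
rewrite (@convE _ _ _ [:: 0]) // ?big_seq1 ?subr0 // => i.
by rewrite inE /= => /negPf ->; rewrite mul0r.
Qed.

Lemma lcoef_mul_const (c : R) f k : conv (lcoef f) (lcoef (lconst c)) k = lcoef f k * c.
Proof.
rewrite (@convE _ _ _ [:: k]) // ?big_seq1 /= ?subrr // => i.
by rewrite inE subr_eq0 eq_sym => /negPf ->; rewrite mulr0.
Qed.

Lemma lmul1l : left_id (lconst 1) lmul.
Proof. by move=> f; apply: laurentP => k; rewrite [LHS]lcoef_const_mul mul1r. Qed.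

Lemma lmul1r : right_id (lconst 1) lmul.
Proof. by move=> f; apply: laurentP => k; rewrite [LHS]lcoef_mul_const mulr1. Qed.

Lemma lmulE3 f g h k : exists s : seq int,
  [/\ conv (lcoef f) (lcoef h) k = \sum_(i <- s) lcoef f i * lcoef h (k - i),
      conv (lcoef g) (lcoef h) k = \sum_(i <- s) lcoef g i * lcoef h (k - i) &
      conv (lcoef (ladd f g)) (lcoef h) k =
        \sum_(i <- s) lcoef (ladd f g) i * lcoef h (k - i)].
Proof.
have [a fa] := lcoef_bound f; have [b gb] := lcoef_bound g.
have [c hc] := lcoef_bound h.
pose N := Num.max a b; exists (irange N (absz (N + c - k)%R).+1).
by split; apply: convE; rewrite ?irange_uniq // => i; rewrite mem_irange => iS /=;
  (have [Ni|iN] := ltP N i;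
    [move: Ni; rewrite gt_max => /andP[/fa fi /gb gi];
     rewrite ?fi ?gi ?addr0 mul0r | rewrite hc ?mulr0 //; lia]).
Qed.

Lemma lmulE3r f g h k : exists s : seq int,
  [/\ conv (lcoef h) (lcoef f) k = \sum_(i <- s) lcoef h i * lcoef f (k - i),
      conv (lcoef h) (lcoef g) k = \sum_(i <- s) lcoef h i * lcoef g (k - i) &
      conv (lcoef h) (lcoef (ladd f g)) k =
        \sum_(i <- s) lcoef h i * lcoef (ladd f g) (k - i)].
Proof.
have [a fa] := lcoef_bound f; have [b gb] := lcoef_bound g.
have [c hc] := lcoef_bound h.
pose N := Num.max a b; exists (irange c (absz (N + c - k)%R).+1).
by split; apply: convE; rewrite ?irange_uniq // => i; rewrite mem_irange => iS /=;
  (have [Ni|iN] := ltP c i; [by rewrite hc ?mul0r |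
     rewrite ?(fa (k - i)) ?(gb (k - i)) ?addr0 ?mulr0 //; lia]).
Qed.

Lemma lmulDl : left_distributive lmul +%R.
Proof.
move=> f g h; apply: laurentP => k /=; have [s [-> -> ->]] := lmulE3 f g h k.
by rewrite -big_split; apply: eq_bigr => i _; exact: mulrDl.
Qed.

Lemma lmulDr : right_distributive lmul +%R.
Proof.
move=> h f g; apply: laurentP => k /=; have [s [-> -> ->]] := lmulE3r f g h k.
by rewrite -big_split; apply: eq_bigr => i _; exact: mulrDr.
Qed.

HB.instance Definition _ := GRing.Zmodule_isPzRing.Build laurent
  lmulA lmul1l lmul1r lmulDl lmulDr.

Lemma lvar_bound :
  exists N : int, forall k : int, N < k -> (k == 1)%:R = 0 :> R.
Proof. by exists 1 => k; case: eqP => // ->; rewrite ltxx. Qed.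

Definition lvar : laurent := Laurent lvar_bound.

Lemma lser_bound (c : nat -> R) :
  exists N : int, forall k : int, N < k -> (if k <= 0 then c `|k|%N else 0) = 0.
Proof. by exists 0 => k; rewrite ltNge => /negPf ->. Qed.

(** c 0 + c 1 u^-1 + c 2 u^-2 + ... *)
Definition lser (c : nat -> R) : laurent := Laurent (lser_bound c).

End Laurent.

Notation "''u'" := (lvar _) : ring_scope.

Section LaurentMap.
Variables (R S : pzRingType) (f : {additive R -> S}).

Lemma lmap_bound (p : laurent R) :
  exists N : int, forall k, N < k -> f (lcoef p k) = 0.
Proof.
by have [N pN] := lcoef_bound p; exists N => k /pN ->; rewrite raddf0.
Qed.

Definition lmap (p : laurent R) : laurent S := Laurent (lmap_bound p).

End LaurentMap.

(** Indices start at 0: i : 'I_m stands for i+1, and a : 'I_n for m+a+1. *)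

Section Transvector.
Variables (K : fieldType) (m n : nat).

Local Notation U := (Ugl K (m + n)).
Local Notation lo := (@lshift m n).
Local Notation hi := (@rshift m n).

(** By the Poincare-Birkhoff-Witt theorem U(h) is the subalgebra of U(gl(m+n))
    generated by h. *)
Inductive Uh : U -> Prop :=
  | Uh_E (i : 'I_m) : Uh (E K (lo i) (lo i))
  | Uh_scal (c : K) : Uh c%:A
  | Uh_add x y : Uh x -> Uh y -> Uh (x + y)
  | Uh_mul x y : Uh x -> Uh y -> Uh (x * y).

Definition A' : Type := localization (fun x : U => Uh x /\ x <> 0).
HB.instance Definition _ := GRing.PzRing.on A'.
HB.instance Definition _ := GRing.Lmodule.on A'.

Definition iota_A' : U -> A' := loc (fun x : U => Uh x /\ x <> 0).
HB.instance Definition _ := GRing.RMorphism.on iota_A'.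

Definition Ea (i j : 'I_(m + n)) : A' := iota_A' (E K i j).

Definition Jdom : pred ('I_m * 'I_m) := fun p => (p.1 < p.2)%N.
Definition Jgen (p : 'I_m * 'I_m) : A' := Ea (lo p.1) (lo p.2).

Definition Z : Type := normquot Jdom Jgen.
HB.instance Definition _ := GRing.PzRing.on Z.

Definition zcls (x : A') : Z := ncls Jdom Jgen x.

Definition cent : {pred U} := fun x =>
  [forall i : 'I_m, forall j : 'I_m, E K (lo i) (lo j) * x == x * E K (lo i) (lo j)].

Lemma centP x :
  reflect (forall i j : 'I_m, E K (lo i) (lo j) * x = x * E K (lo i) (lo j))
    (x \in cent).
Proof.
by apply: (iffP forallP) => [c i j|c i]; [exact/eqP/(forallP (c i)) |
  apply/forallP => j; exact/eqP].
Qed.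

Lemma cent_subsemialg_closed : GRing.subsemialg_closed cent.
Proof.
split.
- by apply/centP => i j; rewrite mulr1 mul1r.
- split=> [|x y /centP cx /centP cy]; apply/centP => i j.
    by rewrite mulr0 mul0r.
  by rewrite mulrDl mulrDr cx cy.
- by move=> c x /centP cx; apply/centP => i j; rewrite -scalerAr cx scalerAl.
- move=> x y /centP cx /centP cy; apply/centP => i j.
  by rewrite mulrA cx -mulrA cy mulrA.
Qed.

Record Ucent : Type := MkUcent { Ucent_val : U; _ : Ucent_val \in cent }.

HB.instance Definition _ := [isSub for Ucent_val].
HB.instance Definition _ := [Choice of Ucent by <:].
HB.instance Definition _ :=
  GRing.SubChoice_isSubAlgebra.Build K U cent Ucent cent_subsemialg_closed.

Lemma cent_norm (x : Ucent) : iota_A' (val x) \in Norm Jdom Jgen.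
Proof.
apply/normP => y /lidealP[c ->]; apply/lidealP.
exists (fun p => c p * iota_A' (val x)); rewrite mulr_suml.
apply: eq_bigr => p _; rewrite -!mulrA; congr (_ * _).
by rewrite -!rmorphM (centP _ (valP x)).
Qed.

Definition nu (x : Ucent) : Z := nq_pi (NormT (cent_norm x)).

Lemma nu_is_zmod_morphism : zmod_morphism nu.
Proof.
move=> x y; rewrite -raddfB; congr nq_pi; apply: val_inj.
by rewrite [RHS]raddfB /= -raddfB.
Qed.

Lemma nu_is_monoid_morphism : monoid_morphism nu.
Proof.
split=> [|x y]; [rewrite -[RHS](rmorph1 (@nq_pi _ _ _ _)) |
  rewrite -[RHS](rmorphM (@nq_pi _ _ _ _))]; congr nq_pi; apply: val_inj.
  by rewrite /= !rmorph1.
by rewrite [RHS]rmorphM /= -rmorphM.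
Qed.

HB.instance Definition _ :=
  GRing.isZmodMorphism.Build Ucent Z nu nu_is_zmod_morphism.
HB.instance Definition _ :=
  GRing.isMonoidMorphism.Build Ucent Z nu nu_is_monoid_morphism.

(** h_i = E_ii - i + 1; the shift by 1 is absorbed by the numbering from 0. *)
Definition hA (i : 'I_m) : A' := Ea (lo i) (lo i) - i%:R.

(** E_(x l1) E_(l1 l2) ... E_(ls a) *)
Fixpoint up_path (x : 'I_m) (l : seq 'I_m) (a : 'I_n) : A' :=
  if l is y :: l' then Ea (lo x) (lo y) * up_path y l' a
  else Ea (lo x) (hi a).

(** E_(l1 x) E_(l2 l1) ... E_(a ls) *)
Fixpoint down_path (x : 'I_m) (l : seq 'I_m) (a : 'I_n) : A' :=
  if l is y :: l' then Ea (lo y) (lo x) * down_path y l' a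
  else Ea (hi a) (lo x).

(** The sums over i > i_1 > ... > i_s and over i < i_1 < ... < i_s are indexed
    by the subset I = {i_1, ..., i_s}; [enum I] lists I in increasing order. *)
Definition raiseA (i : 'I_m) (a : 'I_n) : A' :=
  \sum_(I : {set 'I_m} | I \subset [set j : 'I_m | (j < i)%N])
    up_path i (rev (enum I)) a *
    \prod_(j < m | (j < i)%N && (j \notin I)) (hA i - hA j).

Definition lowerA (a : 'I_n) (i : 'I_m) : A' :=
  \sum_(I : {set 'I_m} | I \subset [set j : 'I_m | (i < j)%N])
    down_path i (enum I) a *
    \prod_(j < m | (i < j)%N && (j \notin I)) (hA i - hA j).

Definition EZ (a b : 'I_n) : Z := zcls (Ea (hi a) (hi b)).
Definition hZ (i : 'I_m) : Z := zcls (hA i).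
Definition raise (i : 'I_m) (a : 'I_n) : Z := zcls (raiseA i a).
Definition lower (a : 'I_n) (i : 'I_m) : Z := zcls (lowerA a i).

(** R(h) acts on Z by multiplication by classes of its elements. *)
Definition hdiffV (i j : 'I_m) : Z := zcls (rinv (hA i - hA j)).

(** The increasing enumeration of C_a = {1, ..., m, m + a}. *)
Definition cidx (a : 'I_n) (r : 'I_m.+1) : 'I_(m + n) :=
  if unlift ord_max r is Some i then lo i else hi a.

(** qdet(1 + E u^-1) restricted to rows C_a and columns C_b; the factor with
    index r, counted from 0, has the spectral parameter u - r. *)
Definition qdetC (a b : 'I_n) : laurent U :=
  \sum_(s : 'S_m.+1) (-1) ^+ s *
    \prod_(r < m.+1)
      ((cidx a (s r) == cidx b r)%:R +
       lconst (E K (cidx a (s r)) (cidx b r)) * rinv ('u - r%:R)).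

Definition tser (a b : 'I_n) : laurent (yangian K n) := lser (tgen K a b).

Definition Tser (a b : 'I_n) : laurent (yangian K n) :=
  \prod_(k < m.+1) ('u - k%:R) * tser a b.

End Transvector.

Arguments EZ {K m n}.
Arguments hZ {K m n}.
Arguments raise {K m n}.
Arguments lower {K m n}.
Arguments hdiffV {K m n}.
Arguments tser {K n}.
Arguments Tser {K} m {n}.
Arguments qdetC {K m n}.

(* Main.v *)
From HB Require Import structures.
From Stdlib Require Import Ncring Ncring_tac.
Require Import Defs.
From mathcomp Require Import all_boot all_order perm all_algebra reals.
From mathcomp Require Import zify ring.
From mathcomp Require boolp.

Set Implicit Arguments.
Unset Strict Implicit.
Unset Printing Implicit Defensive.

Import GRing.Theory.
Local Open Scope ring_scope.
Local Open Scope complex_scope.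

(** The quantum minor is antisymmetric in its columns, so the column b may be
    put first.  Expanding along the last column and dropping the terms ending
    in E_ij with i < j then gives a recursion modulo J whose solution is a sum
    over subsets {w_1 < ... < w_s} of {1, ..., m} of the paths
    E_(w_1 b) E_(w_2 w_1) ... E_(a w_s) times the product of -(u + h_j - 1)
    over the remaining j.  Lagrange interpolation at u = 1 - h_i expresses it
    through its values at these points, where only the subsets containing i
    survive; cutting the paths at i factors the value as s_ib s_ai, once the
    factors E of s_ib are brought into the opposite order.  This is the second
    formula.  The first one is the second formula for the image of the minor
    under E_ij -> - E_j'i', where ' reverses {1, ..., m}; this uses that the
    column form and the row form of a quantum minor agree.  *)

(** Both formulas are first proved for any family [E] with the commutation relations of gl, any left
    ideal [J] containing E_ij for i < j, and any central [U]. They are then used over Laurent series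
    in A' with [U] = u, and the passage to the dual family stays inside the same setting.

    Since J is only a left ideal, the minor has to be arranged with the factors E_ij, i < j,
    rightmost. This order leads to s_ib s_ai. The automorphism E_ij -> - E_j'i' exchanges raising
    and lowering operators, so it produces the opposite product without a second evaluation; it
    replaces u by m - u, which accounts for the different shifts in the two formulas.

    The antisymmetry arguments show that a sum equals its own negative, and the column and row forms
    are compared through a double sum that is N! times each of them; hence the assumption of no
    torsion.

    A class in Z is meaningful only for an element that normalizes J, any other element being sent
    to 0. So s_ib, s_ai, E_ab, h_i and the inverses of h_i - h_j must all be shown to lie in the
    normalizer. *)

#[local] Instance pzRing_ops (B : pzRingType) :
  @Ring_ops B 0 1 +%R *%R (fun x y : B => x - y) -%R (@eq B) := {}.

#[local] Instance pzRing_Ring (B : pzRingType) : Ring (Ro := pzRing_ops B).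
Proof.
split; rewrite /equality /eq_notation /addition /add_notation /multiplication
  /mul_notation /opposite /opp_notation /zero /one /zero_notation
  /one_notation /sub_notation /=.
- exact: eq_equivalence.
- by move=> x _ <- y _ <-.
- by move=> x _ <- y _ <-.
- by move=> x _ <- y _ <-.
- by move=> x _ <-.
- exact: add0r.
- exact: addrC.
- exact: addrA.
- exact: mul1r.
- exact: mulr1.
- exact: mulrA.
- exact: mulrDl.
- by move=> x y z; exact: mulrDr.
- by [].
- exact: subrr.
Qed.

(** The commutation relations only allow the exchange of neighbouring factors in an ordered product,
    so statements about permutations are reduced to adjacent transpositions. *)
Lemma perm_adjacent_ind (N : nat) (P : 'S_N -> Prop) :
  P 1%g ->
  (forall (i j : 'I_N) s, j = i.+1 :> nat -> P s -> P (tperm i j * s)%g) ->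
  forall s, P s.
Proof.
move=> P1 PM s; have Ptperm d : forall (i j : 'I_N) s, (j = i + d :> nat)%N ->
    P s -> P (tperm i j * s)%g.
  elim: d => [|d IHd] i j {}s ji Ps.
    have -> : j = i by apply: val_inj; rewrite /= ji addn0.
    by rewrite tperm1 mul1g.
  case: d IHd ji => [|d] IHd ji; first by apply: PM => //; rewrite ji addn1.
  have kN : (i + d.+1 < N)%N by have := ltn_ord j; lia.
  pose k := Ordinal kN.
  have ik : i != k by rewrite -val_eqE /=; lia.
  have kj : k != j by rewrite -val_eqE /=; lia.
  have ij : i != j by rewrite -val_eqE /=; lia.
  (* With [k] just before [j], conjugating by the adjacent [tperm k j] shortens the distance by
     one. *)
  have -> : tperm i j = (tperm i k ^ tperm k j)%g.
    by rewrite tpermJ tpermL tpermD // eq_sym.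
  rewrite /conjg tpermV.
  rewrite -!mulgA; apply: (PM); [rewrite ji /=; lia|].
  by apply: IHd => //; apply: PM => //; rewrite ji /=; lia.
have [ts -> _] := prod_tpermP s; elim: ts => [|[i j] ts IH]; first by rewrite big_nil.
rewrite big_cons /=; have [le_ij|lt_ji] := leqP i j.
  by apply: (Ptperm (j - i)%N) => //; rewrite subnKC.
by rewrite tpermC; apply: (Ptperm (i - j)%N) => //; rewrite subnKC // ltnW.
Qed.

Section Torsion.
Variables (V : zmodType).
(** Used to divide by 2 in alternating sums, whose involution may have fixed points, and by N! in
    double antisymmetrizations. *)
Definition torsion_free := forall n (x : V), x *+ n.+1 = 0 -> x = 0.

Lemma sum_alternating0 (T : finType) (f : T -> T) (F : T -> V) : torsion_free ->
  involutive f -> (forall x, F (f x) = - F x) -> \sum_x F x = 0.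
Proof.
move=> tf fK Ff; apply: (tf 1); rewrite mulr2n {1}(reindex_inj (inv_inj fK)) /=.
by under eq_bigr do rewrite Ff; rewrite sumrN addNr.
Qed.
End Torsion.

Lemma prod_adjacent (B : pzRingType) N (i j : 'I_N) (F : 'I_N -> B) :
  j = i.+1 :> nat ->
  \prod_r F r = (\prod_(r : 'I_N | (r < i)%N) F r) * (F i * F j) *
                (\prod_(r : 'I_N | (j < r)%N) F r).
Proof.
move=> ji; pose G k := oapp F 1 (insub k : option 'I_N).
have GE (P : pred nat) : \prod_(r : 'I_N | P r) F r = \prod_(0 <= k < N | P k) G k.
  by rewrite big_mkord; apply: eq_bigr => r _; rewrite /G valK.
have GF (r : 'I_N) : F r = G r by rewrite /G valK.
have jN := ltn_ord j; rewrite (GE predT) (GE (fun r => r < i)%N) (GE (fun r => j < r)%N) !GF.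
rewrite -(big_nat_widenl _ _ _ predT) //.
rewrite -(big_nat_widen _ _ _ predT) /=; last exact/ltnW/ltn_ord.
rewrite (big_cat_nat (n := i)) //=; last exact/ltnW/ltn_ord.
by rewrite ji (@big_ltn _ _ _ i N) ?ltn_ord // (@big_ltn _ _ _ i.+1 N) -?ji // !mulrA.
Qed.

Definition central (B : pzRingType) (x : B) := forall y, x * y = y * x.

(** * Quantum minors *)

Section ColumnDeterminant.
Variables (B : pzRingType) (I : eqType) (E : I -> I -> B).

(** The index type and the ring are left open: the relations are used for U(gl), for its image in
    A', for constant Laurent series, and for the dual family [- E y x]. *)
Definition gl_relations := forall x y z t,
  E x y * E z t - E z t * E x y = E x t *+ (y == z) - E z y *+ (x == t).

Definition Lop (w : B) x y := E x y + w *+ (x == y).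

(** The quantum minor with denominators cleared: multiplying the r-th factor by w_r = u - r turns
    delta + E (u - r)^-1 into [Lop]. Rows are permuted and columns stay in order, which makes this
    the column form. *)
Definition cdet N (c d : 'I_N -> I) (w : 'I_N -> B) :=
  \sum_(s : 'S_N) (-1) ^+ s * \prod_(r < N) Lop (w r) (c (s r)) (d r).

(** This is the antisymmetry in the columns p, q of the 2 x 2 quantum minor with rows x, y. The drop
    of the parameter from v to v - 1 compensates the commutators. *)
Lemma Lop_det2 (v : B) x y p q : gl_relations -> central v ->
  Lop v x p * Lop (v - 1) y q + Lop v x q * Lop (v - 1) y p =
  Lop v y p * Lop (v - 1) x q + Lop v y q * Lop (v - 1) x p.
Proof.
move=> Egl vC; rewrite /Lop.
have := Egl x p y q; have := Egl x q y p.
rewrite (eq_sym p y) (eq_sym q y) !mulrb.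
move=> /eqP; rewrite subr_eq => /eqP e1 /eqP; rewrite subr_eq => /eqP e2.
have [vxp vxq vyp vyq] : [/\ v * E x p = E x p * v, v * E x q = E x q * v,
  v * E y p = E y p * v & v * E y q = E y q * v] by split; exact: vC.
rewrite !mulrDl !mulrDr e1 e2.
do 4?[case: ifP => _]; rewrite ?(vxp, vxq, vyp, vyq, mulr0, mul0r, addr0); non_commutative_ring.
Qed.

Hypothesis Egl : gl_relations.
Hypothesis Btf : torsion_free B.

Lemma cdet_tperm N (c d : 'I_N -> I) w (i j : 'I_N) : j = i.+1 :> nat ->
  central (w i) -> w j = w i - 1 ->
  cdet c (d \o tperm i j) w = - cdet c d w.
Proof.
move=> ji wC wj; have ij : i != j by rewrite -val_eqE /= ji; lia.
apply/eqP; rewrite -addr_eq0 -big_split /=; apply/eqP.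
(* The permutations s and (i j) s differ by a sign and by the exchange of two neighbouring rows;
   [Lop_det2] shows that, after adding both orders of the columns, only the sign remains. *)
apply: (sum_alternating0 (f := fun s => (tperm i j * s)%g) Btf).
  by move=> s /=; rewrite mulgA tperm2 mul1g.
move=> s; rewrite -!mulrDr odd_permM odd_tperm ij signr_addb /= expr1 -mulrA mulN1r.
congr (- (_ * _)).
have off r : r != i -> r != j -> (tperm i j * s)%g r = s r.
  by move=> ri rj; rewrite permM tpermD // eq_sym.
have si : (tperm i j * s)%g i = s j by rewrite permM tpermL.
have sj : (tperm i j * s)%g j = s i by rewrite permM tpermR.
rewrite !(prod_adjacent _ ji) /= tpermL tpermR !si !sj wj.
have dT r : r != i -> r != j -> d (tperm i j r) = d r.
  by move=> ri rj; rewrite tpermD // eq_sym.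
have lti (r : 'I_N) : (r < i)%N -> r != i /\ r != j.
  by rewrite -!val_eqE /=; lia.
have ltj (r : 'I_N) : (j < r)%N -> r != i /\ r != j.
  by rewrite -!val_eqE /=; lia.
set P := \prod_(r < N | (r < i)%N) Lop (w r) (c (s r)) (d r).
set Q := \prod_(r < N | (j < r)%N) Lop (w r) (c (s r)) (d r).
have eP d' s' : (forall r, r != i -> r != j -> d' r = d r) ->
    (forall r, r != i -> r != j -> s' r = s r) ->
    \prod_(r < N | (r < i)%N) Lop (w r) (c (s' r)) (d' r) = P.
  by move=> d'E s'E; apply: eq_bigr => r /lti[ri rj]; rewrite d'E ?s'E.
have eQ d' s' : (forall r, r != i -> r != j -> d' r = d r) ->
    (forall r, r != i -> r != j -> s' r = s r) ->
    \prod_(r < N | (j < r)%N) Lop (w r) (c (s' r)) (d' r) = Q.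
  by move=> d'E s'E; apply: eq_bigr => r /ltj[ri rj]; rewrite d'E ?s'E.
rewrite !(eP (fun r => d (tperm i j r))) // !eP // !(eQ (fun r => d (tperm i j r))) // !eQ //.
by rewrite -!mulrDl -!mulrDr [X in _ * X * _ = _]addrC Lop_det2 // addrC.
Qed.

Lemma cdet_perm N (c d : 'I_N -> I) w (s : 'S_N) :
  (forall i, central (w i)) ->
  (forall i j : 'I_N, j = i.+1 :> nat -> w j = w i - 1) ->
  cdet c (d \o s) w = (-1) ^+ s * cdet c d w.
Proof.
move=> wC wj; elim/perm_adjacent_ind: s d => [|i j s ji IH] d.
  by rewrite odd_perm1 mul1r; congr cdet; apply: boolp.funext => r /=; rewrite perm1.
have -> : d \o (tperm i j * s)%g = (d \o s) \o tperm i j.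
  by apply: boolp.funext => r /=; rewrite permM.
rewrite (cdet_tperm _ _ ji) ?IH //; last exact: wj.
have ij : i != j by rewrite -val_eqE /= ji; lia.
by rewrite odd_permM odd_tperm ij signr_addb /= expr1 -mulrA mulN1r.
Qed.

Lemma cdet_row_perm N (c d : 'I_N -> I) w (s : 'S_N) :
  cdet (c \o s) d w = (-1) ^+ s * cdet c d w.
Proof.
rewrite /cdet mulr_sumr (reindex_inj (mulIg (s^-1)%g)) /=; apply: eq_bigr => t _.
rewrite odd_permM odd_permV addbC signr_addb -mulrA; congr (_ * (_ * _)).
apply: eq_bigr => r _; congr (Lop _ _ _).
by rewrite -permM -mulgA mulVg mulg1.
Qed.

(** Antisymmetrizing rows and columns at once removes the preference for the column form. The result
    is symmetric in the parameters, which makes it possible to reverse them. *)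
Definition ddet N (c d : 'I_N -> I) (w : 'I_N -> B) :=
  \sum_(s : 'S_N) \sum_(t : 'S_N) (-1) ^+ s * (-1) ^+ t *
    \prod_(r < N) Lop (w r) (c (s r)) (d (t r)).

Lemma ddetE N (c d : 'I_N -> I) w :
  (forall i, central (w i)) ->
  (forall i j : 'I_N, j = i.+1 :> nat -> w j = w i - 1) ->
  ddet c d w = cdet c d w *+ N`!.
Proof.
move=> wC wj; rewrite /ddet exchange_big /=.
rewrite (eq_bigr (fun=> cdet c d w)) ?sumr_const ?card_Sn // => t _.
transitivity ((-1) ^+ t * cdet c (d \o t) w); last first.
  by rewrite cdet_perm // mulrA -signr_addb addbb mul1r.
by rewrite mulr_sumr; apply: eq_bigr => s _; rewrite mulrA -!signr_addb addbC.
Qed.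

(** Exchanging two adjacent parameters v, w changes a product of two factors by
    (v - w) (delta_xp E_yq - delta_yq E_xp), which is antisymmetric under the
    simultaneous exchange of the rows x, y and of the columns p, q. *)
Lemma ddet_perm N (c d : 'I_N -> I) w (p : 'S_N) :
  (forall i, central (w i)) -> ddet c d (w \o p) = ddet c d w.
Proof.
elim/perm_adjacent_ind: p w => [|i j p ji IH] w wC.
  by congr ddet; apply: boolp.funext => r /=; rewrite perm1.
have -> : w \o (tperm i j * p)%g = (w \o p) \o tperm i j.
  by apply: boolp.funext => r /=; rewrite permM.
rewrite -[RHS]IH //.
have {}wC k : central ((w \o p) k) by exact: wC.
move: (w \o p) wC => {IH p}w wC.
have ij : i != j by rewrite -val_eqE /= ji; lia.
have ijN : (tperm i j : bool) by rewrite odd_tperm.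
apply/eqP; rewrite -subr_eq0 /ddet !pair_bigA /= -sumrB; apply/eqP.
apply: (sum_alternating0
  (f := fun st : 'S_N * 'S_N => (tperm i j * st.1, tperm i j * st.2)%g) Btf).
  by move=> [s t] /=; rewrite !mulgA tperm2 !mul1g.
move=> [s t] /=; rewrite -!signr_addb !odd_permM ijN /=.
have -> : ~~ s (+) ~~ t = s (+) t by case: odd_perm; case: odd_perm.
rewrite -!mulrBr -mulrN; congr (_ * _).
have si (q : 'S_N) : (tperm i j * q)%g i = q j by rewrite permM tpermL.
have sj (q : 'S_N) : (tperm i j * q)%g j = q i by rewrite permM tpermR.
have off (q : 'S_N) r : r != i -> r != j -> (tperm i j * q)%g r = q r.
  by move=> ri rj; rewrite permM tpermD // eq_sym.
have wT r : r != i -> r != j -> w (tperm i j r) = w r.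
  by move=> ri rj; rewrite tpermD // eq_sym.
have lti (r : 'I_N) : (r < i)%N -> r != i /\ r != j.
  by rewrite -!val_eqE /=; lia.
have ltj (r : 'I_N) : (j < r)%N -> r != i /\ r != j.
  by rewrite -!val_eqE /=; lia.
rewrite !(prod_adjacent _ ji) /= tpermL tpermR !si !sj.
set P := \prod_(r < N | (r < i)%N) Lop (w r) (c (s r)) (d (t r)).
set Q := \prod_(r < N | (j < r)%N) Lop (w r) (c (s r)) (d (t r)).
have eP w' s' t' : (forall r, r != i -> r != j -> w' r = w r) ->
    (forall r, r != i -> r != j -> s' r = s r) ->
    (forall r, r != i -> r != j -> t' r = t r) ->
    \prod_(r < N | (r < i)%N) Lop (w' r) (c (s' r)) (d (t' r)) = P.
  by move=> w'E s'E t'E; apply: eq_bigr => r /lti[ri rj]; rewrite w'E ?s'E ?t'E.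
have eQ w' s' t' : (forall r, r != i -> r != j -> w' r = w r) ->
    (forall r, r != i -> r != j -> s' r = s r) ->
    (forall r, r != i -> r != j -> t' r = t r) ->
    \prod_(r < N | (j < r)%N) Lop (w' r) (c (s' r)) (d (t' r)) = Q.
  by move=> w'E s'E t'E; apply: eq_bigr => r /ltj[ri rj]; rewrite w'E ?s'E ?t'E.
rewrite !(eP (fun r => w (tperm i j r))) ?(eP w) //; try by move=> *; apply: off.
rewrite !(eQ (fun r => w (tperm i j r))) ?(eQ w) //; try by move=> *; apply: off.
rewrite -!mulrBl -!mulrBr.
set A := (X in P * X * Q = _); set A' := (X in _ = - (P * X * Q)).
suff -> : A = - A' by rewrite mulrN mulNr.
rewrite /A /A' /Lop; move: (c _) (d _) (c _) (d _) => x p y q.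
have [wxp wyq] : w i * E x p = E x p * w i /\ w i * E y q = E y q * w i by split; exact: wC.
have [wxp' wyq'] : w j * E x p = E x p * w j /\ w j * E y q = E y q * w j by split; exact: wC.
have wij : w i * w j = w j * w i by exact: wC.
rewrite !mulrb !mulrDl !mulrDr; do 2?[case: ifP => _];
  rewrite ?(wxp, wyq, wxp', wyq', wij, mulr0, mul0r, addr0); non_commutative_ring.
Qed.

End ColumnDeterminant.

Lemma gl_relations_opp_transpose (B : pzRingType) (I : eqType) (E : I -> I -> B) :
  gl_relations E -> gl_relations (fun x y => - E y x).
Proof.
move=> Egl x y z t; rewrite !mulrNN -opprB Egl [x == t]eq_sym [y == z]eq_sym.
by rewrite opprB !mulNrn opprK addrC.
Qed.

Lemma torsion_free_inj (B : zmodType) n (x y : B) : torsion_free B ->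
  x *+ n.+1 = y *+ n.+1 -> x = y.
Proof.
move=> tf xy; apply/eqP; rewrite -subr_eq0; apply/eqP/(tf n).
by rewrite mulrnBl xy subrr.
Qed.

(** Each [Lop] is minus the transposed [Lop] of the dual family at the opposite parameter, so the
    column form of the dual is the row form of [E] up to sign. Negation makes the parameters
    increase; reversing them, allowed for [ddet], restores the decrease by 1. Cancelling N! returns
    to [cdet]. *)
Lemma cdet_opp_transpose (B : pzRingType) (I : eqType) (E : I -> I -> B) N
    (c d : 'I_N -> I) w :
  gl_relations E -> torsion_free B ->
  (forall i, central (w i)) ->
  (forall i j : 'I_N, j = i.+1 :> nat -> w j = w i - 1) ->
  cdet E c d w =
  (-1) ^+ N * cdet (fun x y => - E y x) d c (fun r => - w (rev_ord r)).
Proof.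
move=> Egl Btf wC wj; set E' := fun x y => - E y x.
have Egl' : gl_relations E' by exact: gl_relations_opp_transpose.
pose w' r := - w (rev_ord r).
have w'C i : central (w' i) by move=> y; rewrite mulNr mulrN wC.
have w'j (i j : 'I_N) : j = i.+1 :> nat -> w' j = w' i - 1.
  move=> ji; rewrite /w' (wj (rev_ord j) (rev_ord i)) ?opprB 1?addrAC ?subrr ?add0r //=.
  by have := ltn_ord j; lia.
have Nfact : N`! = (N`!).-1.+1 by rewrite prednK // fact_gt0.
apply: (@torsion_free_inj _ (N`!).-1) => //; rewrite -Nfact.
rewrite -mulrnAr -!ddetE // -(ddet_perm E Btf c d (perm (@rev_ord_inj N))) //.
rewrite /ddet exchange_big /= mulr_sumr; apply: eq_bigr => s _.
rewrite mulr_sumr; apply: eq_bigr => t _.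
rewrite [X in _ = X]mulrA -(commr_sign _ N) -[X in _ = X]mulrA -!signr_addb addbC.
congr (_ * _).
rewrite -[X in (-1) ^+ X]card_ord -prodrN; apply: eq_bigr => r _.
by rewrite /Lop /= permE /E' opprD !opprK mulNrn opprK eq_sym.
Qed.

Lemma lift_perm_onto N (j : 'I_N.+1) (s : 'S_N.+1) :
  s ord_max = j -> exists t, s = lift_perm ord_max j t.
Proof.
move=> sj; pose f k := odflt k (unlift j (s (lift ord_max k))).
have fE k : lift j (f k) = s (lift ord_max k).
  rewrite /f; case: unliftP => [k' -> //|] /esym; rewrite -sj => /perm_inj /eqP.
  by rewrite (negPf (neq_lift _ _)).
have f_inj : injective f.
  by move=> k l fkl; apply/(@lift_inj _ ord_max)/(@perm_inj _ s); rewrite -!fE fkl.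
exists (perm f_inj); apply/permP => k.
by case: (unliftP ord_max k) => [k'|] ->; rewrite ?lift_perm_id ?lift_perm_lift ?permE.
Qed.

Lemma lift_perm_inj N (i j : 'I_N.+1) : injective (lift_perm i j : 'S_N -> 'S_N.+1).
Proof.
move=> s t st; apply/permP => k; apply/(@lift_inj _ j).
by rewrite -!(lift_perm_lift i) st.
Qed.

Lemma cdet_expand_last (B : pzRingType) (I : eqType) (E : I -> I -> B) N
    (c d : 'I_N.+1 -> I) w :
  cdet E c d w = \sum_(j < N.+1) (-1) ^+ (N + j) *
    (cdet E (c \o lift j) (d \o lift ord_max) (w \o lift ord_max) *
     Lop E (w ord_max) (c j) (d ord_max)).
Proof.
rewrite /cdet (partition_big (fun s : 'S_N.+1 => s ord_max) predT) //=.
apply: eq_bigr => j _; rewrite (reindex (lift_perm ord_max j)); last first.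
  exists (fun s => odflt 1%g [pick t | lift_perm ord_max j t == s]) => [t _|s].
    by case: pickP => [t' /eqP/lift_perm_inj //|/(_ t)]; rewrite eqxx.
  move=> /eqP/lift_perm_onto[t ->]; case: pickP => [t' /eqP //|/(_ t)].
  by rewrite eqxx.
rewrite mulr_suml mulr_sumr; apply: eq_big => [s|s _].
  by rewrite lift_perm_id eqxx.
rewrite big_ord_recr /= lift_perm_id odd_lift_perm /= signr_addb -!mulrA.
rewrite -oddD signr_odd; congr (_ * (_ * (_ * _))).
apply: eq_bigr => r _; have -> : widen_ord (leqnSn N) r = lift ord_max r.
  by apply: val_inj; rewrite /= /bump leqNgt ltn_ord.
by rewrite lift_perm_lift.
Qed.

(** * Sums over chains of indices *)

(** With [transp E] the paths below read E_(x l1) E_(l1 l2) ... E_(ls z), as in raising operators;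
    with [E] they read as in lowering operators. *)
Definition transp (I : Type) (B : Type) (E : I -> I -> B) : I -> I -> B :=
  fun x y => E y x.

Section Chain.
Variables (B : pzRingType) (I : eqType) (lo : nat -> I).
Implicit Types (E : I -> I -> B) (y : nat -> B) (x z : I) (w : seq nat).

Fixpoint path_prod E x (l : seq nat) z : B :=
  if l is p :: l' then E (lo p) x * path_prod E (lo p) l' z else E z x.

(** The sum over the subsequences w_1, ..., w_s of w of
    E_(w_1 x) E_(w_2 w_1) ... E_(z w_s), each multiplied on the right by the
    y_j for the omitted j, the first elements of w being rightmost. *)
Fixpoint chain E y x w z : B :=
  if w is p :: w' then
    E (lo p) x * chain E y (lo p) w' z + chain E y x w' z * y p
  else E z x.

(** Recursion at the last index, which is the one that the expansion of a minor along its last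
    column produces. The y_j of earlier indices must pass the new factors, hence the commutation
    hypotheses. *)
Lemma chain_rcons E y x w p z :
  {in w, forall j, GRing.comm (y j) (E z (lo p))} ->
  {in w, forall j, GRing.comm (y j) (y p)} ->
  chain E y x (rcons w p) z = chain E y x w (lo p) * E z (lo p) + chain E y x w z * y p.
Proof.
elim: w x => [//|q w IH] x yE yy /=.
have yE' : {in w, forall j, GRing.comm (y j) (E z (lo p))}.
  by move=> j jw; apply: yE; rewrite inE jw orbT.
have yy' : {in w, forall j, GRing.comm (y j) (y p)}.
  by move=> j jw; apply: yy; rewrite inE jw orbT.
rewrite !IH // !mulrDl !mulrDr -!mulrA -(yE q) ?mem_head // -(yy q) ?mem_head //.
by rewrite addrACA.
Qed.

(** Every path has exactly one factor with second index x, the first one; there k becomes k', which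
    commutes with everything that follows. *)
Lemma chain_shift E y x w z (k k' : B) :
  {in z :: map lo w, forall t, k * E t x = E t x * k'} ->
  {in w, forall p, {in z :: map lo w, forall t, GRing.comm k' (E t (lo p))}} ->
  {in w, forall p, GRing.comm k' (y p)} ->
  k * chain E y x w z = chain E y x w z * k'.
Proof.
elim: w x k => [|p w IH] x k kE k'E k'y /=; first by apply: kE; rewrite mem_head.
have inS t : t \in z :: map lo w -> t \in z :: map lo (p :: w).
  by rewrite !inE => /orP[|] ->; rewrite ?orbT.
have inW q : q \in w -> q \in p :: w by rewrite inE => ->; rewrite orbT.
have k'E' : {in w, forall p, {in z :: map lo w, forall t, GRing.comm k' (E t (lo p))}}.
  by move=> q qw t tw; apply: k'E; [exact: inW|exact: inS].
have k'y' : {in w, forall p, GRing.comm k' (y p)} by move=> q qw; apply/k'y/inW.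
rewrite mulrDr mulrDl !mulrA kE ?inE ?eqxx ?orbT // -!mulrA.
rewrite [k' * chain _ _ _ _ _]IH //; last first.
  by move=> t tw; apply: k'E; rewrite ?mem_head // inS.
rewrite ![k * (_ * _)]mulrA IH // -?mulrA ?(k'y p) ?mem_head //.
by move=> t /inS tw; apply: kE.
Qed.

(** Subsequences omitting i carry the factor y_i = 0, so every surviving path passes through i. The
    y_p with p before i stand to the right of the second part; moved to its left they become y_p +
    1. *)
Lemma chain_split E y x w1 i w2 z : y i = 0 ->
  {in w1, forall p, (y p + 1) * chain E y (lo i) w2 z = chain E y (lo i) w2 z * y p} ->
  chain E y x (w1 ++ i :: w2) z =
  chain E (fun j => y j + 1) x w1 (lo i) * chain E y (lo i) w2 z.
Proof.
move=> yi; elim: w1 x => [|p w1 IH] x yC /=; first by rewrite yi mulr0 addr0.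
have yC' : {in w1, forall p,
    (y p + 1) * chain E y (lo i) w2 z = chain E y (lo i) w2 z * y p}.
  by move=> q qw; apply: yC; rewrite inE qw orbT.
by rewrite !IH // mulrDl -!mulrA yC ?mem_head.
Qed.

(** A path through s elements of w has s + 1 factors E and |w| - s factors y, so all terms have the
    same number of signs. *)
Lemma chain_opp E y x w z :
  chain (fun s t => - E s t) (fun j => - y j) x w z =
  (-1) ^+ (size w).+1 * chain E y x w z.
Proof.
elim: w x => [|p w IH] x /=; first by rewrite mulN1r.
rewrite !IH !mulNr !mulrN (exprS _ _.+1) mulN1r mulNr mulrDr.
by rewrite !mulrA -(commr_sign (E _ _)) opprD.
Qed.

(** Only the last factor E_(. d) of a path fails to commute with E_(d c), and the commutator
    replaces its end d by c; the other delta term vanishes because c is not visited. *)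
Lemma chain_transp_comm E y x w c d : gl_relations E ->
  x != c -> c \notin map lo w -> d \notin map lo w ->
  {in w, forall p, GRing.comm (y p) (E d c)} ->
  chain (transp E) y x w d * E d c =
  E d c * chain (transp E) y x w d + chain (transp E) y x w c.
Proof.
move=> Egl; elim: w x => [|p w IH] x xc cw dw yE /=.
  by apply/eqP; rewrite /transp addrC -subr_eq Egl eqxx mulr1n (negPf xc) subr0.
move: cw dw; rewrite !inE !negb_or => /andP[cp cw] /andP[dp dw].
have yE' : {in w, forall p, GRing.comm (y p) (E d c)}.
  by move=> q qw; apply: yE; rewrite inE qw orbT.
have Exd : E x (lo p) * E d c = E d c * E x (lo p).
  by apply/eqP; rewrite -subr_eq0 Egl [lo p == d]eq_sym (negPf dp) (negPf xc) subr0.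
have pc : lo p != c by rewrite eq_sym.
have := IH x xc cw dw yE'; have := IH (lo p) pc cw dw yE'.
rewrite {1 2 4}/transp => e1 e2.
rewrite mulrDl -!mulrA (yE p) ?mem_head // e1 (mulrA (chain _ _ _ _ _)) e2.
by rewrite mulrDl !mulrDr !mulrA Exd addrACA.
Qed.

(** Moving the factor E_(l c) that contains the last index [l] to the other end
    of a chain leaves as commutator the chain omitting [l], which turns [y l]
    into [y l + 1]. *)
Lemma chain_transp_rev E y x w c : gl_relations E ->
  x \notin map lo w -> c != x -> c \notin map lo w -> uniq (map lo w) ->
  {in w &, forall p q, GRing.comm (y p) (y q)} ->
  {in w &, forall p q, lo p != lo q ->
    {in c :: map lo w, forall t, t != lo p -> GRing.comm (y p) (E (lo q) t)}} ->
  chain (transp E) y x w c = chain E (fun j => y j + 1) c (rev w) x.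
Proof.
move=> Egl; elim/last_ind: w c => [//|w l IH] c.
rewrite !map_rcons !mem_rcons !inE !negb_or rcons_uniq.
move=> /andP[xl xw] cx /andP[cl cw] /andP[lw uw] yy yE.
have inW q : q \in w -> q \in rcons w l by rewrite mem_rcons inE => ->; rewrite orbT.
have lW : l \in rcons w l by rewrite mem_rcons mem_head.
have inM q : q \in w -> lo q \in map lo w by exact: map_f.
have yy' : {in w &, forall p q, GRing.comm (y p) (y q)}.
  by move=> p q /inW pw /inW qw; exact: yy.
have yEc : {in w, forall p, GRing.comm (y p) (E (lo l) c)}.
  move=> p pw; apply: yE; rewrite ?lW ?inW ?mem_head //.
    by apply: contraNneq lw => <-; exact: inM.
  by apply: contraNneq cw => ->; exact: inM.
rewrite chain_rcons //; last by move=> j /inW jw; exact: yy.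
rewrite {2}/transp chain_transp_comm // ?[x == _]eq_sym //.
rewrite rev_rcons /= !IH // ?[lo l == _]eq_sym //.
- by rewrite mulrDr mulr1 -addrA [_ + _ * y l]addrC.
- move=> p q pw qw pq t; rewrite inE => tw tp; apply: yE; rewrite ?inW //.
  by rewrite inE mem_rcons inE; case/orP: tw => ->; rewrite ?orbT.
- move=> p q pw qw pq t; rewrite inE => tw tp; apply: yE; rewrite ?inW //.
  by rewrite inE mem_rcons inE; case/orP: tw => ->; rewrite ?orbT.
Qed.

(** Subsets containing the first index of w, and those omitting it, give the two terms of [chain].
    The product runs over [rev w] because [chain] puts the factor of the first index rightmost. *)
Lemma sum_path_chain m E y x (w : seq 'I_m) z : uniq w ->
  \sum_(J : {set 'I_m} | J \subset [set j in w])
    path_prod E x [seq val j | j <- w & j \in J] z * \prod_(j <- rev w | j \notin J) y j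
  = chain E y x (map val w) z.
Proof.
elim: w x => [|p w IH] x /=.
  move=> _; rewrite (big_pred1 set0) => [|J]; first by rewrite big_nil mulr1.
  by rewrite set_nil subset0.
move=> /andP[pw uw]; pose W := [set j in w].
have pW : p \notin W by rewrite inE.
have sW (J : {set 'I_m}) : (J \subset [set j in p :: w]) = (J :\ p \subset W).
  have -> : [set j in p :: w] = p |: W by apply/setP => j; rewrite !inE.
  by rewrite subDset.
rewrite (bigID (fun J : {set 'I_m} => p \in J)) /= -!IH // mulr_sumr mulr_suml.
congr (_ + _).
  rewrite (reindex_onto (fun J => p |: J) (fun J => J :\ p)) /=; last first.
    by move=> J /andP[_]; exact: setD1K.
  apply: eq_big => [J|J /andP[/andP[_ _]]].
    rewrite sW setU11 andbT; apply/andP/idP => [[JW /eqP <-] //|JW].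
    have pJ : p \notin J by apply: contra pW; exact: subsetP.
    by rewrite setU1K // eqxx.
  move=> /eqP pJ; rewrite setU11 /= -mulrA; congr (_ * (_ * _)).
    congr (path_prod _ _ [seq val j | j <- _] _); apply: eq_in_filter => j jw.
    by rewrite !inE; case: eqP => // jp; rewrite -jp jw in pw.
  rewrite rev_cons big_rcons /= setU11 /= mulr1.
  rewrite big_seq_cond [RHS]big_seq_cond; apply: eq_bigl => j.
  rewrite mem_rev !inE; case: (boolP (j \in w)) => //= jw.
  by case: eqP => // jp; rewrite -jp jw in pw.
apply: eq_big => [J|J /andP[_ /negPf pJ]].
  case: (boolP (p \in J)) => pJ; rewrite ?andbF ?andbT.
    by symmetry; apply/negP => /subsetP/(_ p pJ); exact/negP.
  have JpJ : J :\ p = J by apply/setDidPl; rewrite disjoint_sym disjoints1.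
  by rewrite sW JpJ.
by rewrite pJ rev_cons big_rcons /= pJ mulrA.
Qed.

End Chain.

(** * Lagrange interpolation *)

Section Lagrange.
Variables (C : comPzRingType) (T : finType) (h : T -> C) (g : T -> T -> C).
Hypothesis gK : forall i j, i != j -> (h i - h j) * g i j = 1.

Lemma lagrange_inv_opp i j : i != j -> g j i = - g i j.
Proof.
move=> ij; rewrite -[LHS]mulr1 -(gK ij) mulrCA mulrA -[h i - h j]opprB mulNr.
by rewrite gK 1?eq_sym // mulNr mul1r.
Qed.

Lemma lagrange_partition_of_unity (W : {set T}) s : W != set0 ->
  \sum_(i in W) \prod_(j in W | j != i) ((s - h j) * g i j) = 1.
Proof.
have [n] := ubnP #|W|; elim: n W s => // n IH W s + /set0Pn[w wW].
have [W' wW' ->] : exists2 W' : {set T}, w \notin W' & W = w |: W'.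
  by exists (W :\ w); rewrite ?setD11 ?setD1K.
rewrite cardsU1 wW' ltnS => Wn {W wW}; rewrite big_setU1 //=.
have [W0|W0] := eqVneq W' set0.
  rewrite W0 big_set0 addr0 big1 // => j.
  by rewrite !inE orbF => /andP[-> ].
have pw (i : T) (F : T -> C) : i \in W' ->
    \prod_(j in w |: W' | j != i) F j = F w * \prod_(j in W' | j != i) F j.
  move=> iW; have wi : w != i by apply: contraNneq wW' => ->.
  rewrite (bigD1 w) ?setU11 //=; congr (_ * _); apply: eq_bigl => j.
  by rewrite !inE; case: eqP => [->|]; rewrite ?(negPf wW') ?andbF ?andbT.
rewrite [X in X + _](_ : _ = \prod_(j in W') ((s - h j) * g w j)); last first.
  apply: eq_bigl => j; rewrite !inE; case: eqP => [->|]; last by rewrite andbT.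
  by rewrite (negPf wW').
rewrite [X in _ + X](_ : _ = 1 - \prod_(j in W') ((s - h j) * g w j)) ?subrKC //.
(* By [gK], (s - h w) g i w = 1 + (s - h i) g i w; the 1 gives the induction hypothesis at s. *)
transitivity (\sum_(i in W') (\prod_(j in W' | j != i) ((s - h j) * g i j) +
    (s - h i) * g i w * \prod_(j in W' | j != i) ((s - h j) * g i j))).
  apply: eq_bigr => i iW; rewrite pw // -[X in _ = X + _]mul1r -mulrDl; congr (_ * _).
  have iw : i != w by apply: contraNneq wW' => <-.
  by rewrite -(gK iw) -mulrDl; congr (_ * _); ring.
rewrite big_split /= IH //; congr (1 + _).
(* In the other part (s - h i) completes the product over W', and what is left is the induction
   hypothesis at the new node h w. *)
transitivity (- (\prod_(j in W') (s - h j) * \prod_(j in W') g w j) *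
    \sum_(i in W') \prod_(j in W' | j != i) ((h w - h j) * g i j)); last first.
  by rewrite IH // mulr1 big_split.
rewrite mulr_sumr; apply: eq_bigr => i iW.
have iw : i != w by apply: contraNneq wW' => <-.
rewrite (bigD1 i iW) [X in - (_ * X)](bigD1 i iW) !big_split /= (lagrange_inv_opp iw).
have e : \prod_(j in W' | j != i) g w j * \prod_(j in W' | j != i) (h w - h j) = 1.
  rewrite -big_split big1 //= => j /andP[jW _]; rewrite mulrC gK //.
  by apply: contraNneq wW' => ->.
move: e; set q1 := \prod_(j in W' | _) g w j; set q2 := \prod_(j in W' | _) (h w - h j) => e.
set p1 := \prod_(j in W' | _) (s - h j); set p2 := \prod_(j in W' | _) g i j.
transitivity ((s - h i) * g i w * (p1 * p2) * (q1 * q2)); last by ring.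
by rewrite e mulr1.
Qed.

(** The interpolated polynomial has degree less than the number of nodes exactly because W is
    nonempty. It vanishes at the nodes outside W; at those in W it factors out and a partition of
    unity over W remains. *)
Lemma lagrange_interpolation (W : {set T}) s : W != set0 ->
  \prod_(j | j \notin W) (s - h j) =
  \sum_i (\prod_(j | j \notin W) (h i - h j)) * \prod_(j | j != i) ((s - h j) * g i j).
Proof.
move=> W0; rewrite [RHS](bigID (fun i => i \in W)) /= [X in _ + X]big1 => [|i iW]; last first.
  by rewrite (bigD1 i) //= subrr !mul0r.
rewrite addr0; transitivity (\prod_(j | j \notin W) (s - h j) *
    \sum_(i in W) \prod_(j in W | j != i) ((s - h j) * g i j)).
  by rewrite lagrange_partition_of_unity ?mulr1.
rewrite mulr_sumr; apply: eq_bigr => i iW.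
rewrite [X in _ = _ * X](bigID (fun j => j \in W)) /= [RHS]mulrCA [RHS]mulrC.
congr (_ * _); last by apply: eq_bigl => j; rewrite andbC.
rewrite [X in _ = _ * X](eq_bigl (fun j => j \notin W)) => [|j]; last first.
  by case: eqP => [->|] //=; rewrite iW.
rewrite -big_split /=; apply: eq_bigr => j jW.
by rewrite mulrCA gK ?mulr1 //; apply: contraNneq jW => <-.
Qed.

End Lagrange.

(** The double commutant of a commuting set is a commutative subring closed
    under inverses; this transports the interpolation formula to [B]. *)
Section DoubleCommutant.
Variables (B : pzRingType) (S : B -> Prop).

Definition dcomm : {pred B} := fun x =>
  boolp.asbool (forall c, (forall s, S s -> GRing.comm c s) -> GRing.comm c x).

Lemma dcommP x : reflect
  (forall c, (forall s, S s -> GRing.comm c s) -> GRing.comm c x) (x \in dcomm).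
Proof. exact: boolp.asboolP. Qed.

Lemma dcomm_subring_closed : subring_closed dcomm.
Proof.
split=> [|x y /dcommP xS /dcommP yS|x y /dcommP xS /dcommP yS]; apply/dcommP => c cS.
- exact: commr1.
- by apply: commrB; [exact: xS|exact: yS].
- by apply: commrM; [exact: xS|exact: yS].
Qed.

HB.instance Definition _ := GRing.isSubringClosed.Build B dcomm dcomm_subring_closed.

Lemma dcomm_gen x : S x -> x \in dcomm.
Proof. by move=> Sx; apply/dcommP => c; apply. Qed.

Lemma dcomm_inv x y : x \in dcomm -> x * y = 1 -> y * x = 1 -> y \in dcomm.
Proof.
move=> /dcommP xS xy yx; apply/dcommP => c /xS cx; rewrite /GRing.comm.
by rewrite -[c * y]mul1r -yx mulrA -[y * x * c]mulrA -cx -!mulrA xy mulr1.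
Qed.

Hypothesis Scomm : forall s t, S s -> S t -> GRing.comm s t.

Lemma dcomm_comm x y : x \in dcomm -> y \in dcomm -> x * y = y * x.
Proof.
move=> /dcommP xS /dcommP yS; apply: yS => s Ss; apply/commr_sym/xS => t St.
exact: Scomm.
Qed.

Record dcommT : Type := DcommT { dcomm_val : B; _ : dcomm_val \in dcomm }.

HB.instance Definition _ := [isSub for dcomm_val].
HB.instance Definition _ := [Choice of dcommT by <:].
HB.instance Definition _ :=
  GRing.SubChoice_isSubPzRing.Build B dcomm dcommT dcomm_subring_closed.

Lemma dcommT_mulC : commutative (@GRing.mul dcommT).
Proof. by move=> x y; apply/val_inj/dcomm_comm; exact: valP. Qed.

Lemma lagrange_dcomm m (h : 'I_m -> B) (g : 'I_m -> 'I_m -> B) (W : {set 'I_m}) s :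
  (forall i j, i != j -> (h i - h j) * g i j = 1) ->
  (forall i j, i != j -> g i j * (h i - h j) = 1) ->
  (forall i, S (h i)) -> S s -> W != set0 ->
  \prod_(j | j \notin W) (s - h j) =
  \sum_i (\prod_(j | j \notin W) (h i - h j)) * \prod_(j | j != i) ((s - h j) * g i j).
Proof.
move=> gr gl Sh Ss W0.
pose C : comPzRingType := HB.pack dcommT
  (GRing.PzRing_hasCommutativeMul.Build dcommT dcommT_mulC).
have hD i : h i \in dcomm by exact/dcomm_gen/Sh.
(* Nothing is known about the diagonal values of [g], so they are replaced by 0 to stay in the
   double commutant; the formula does not see them. *)
pose g' i j := if i == j then 0 else g i j.
have gD i j : g' i j \in dcomm.
  rewrite /g'; have [_|ij] := eqVneq i j; first exact: rpred0.
  by apply: (dcomm_inv _ (gr _ _ ij) (gl _ _ ij)); exact: rpredB.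
pose hC i : C := DcommT (hD i); pose gC i j : C := DcommT (gD i j).
have gCK i j : i != j -> (hC i - hC j) * gC i j = 1.
  by move=> ij; apply: val_inj; rewrite /= /g' (negPf ij) gr.
have := lagrange_interpolation gCK (DcommT (dcomm_gen Ss) : C) W0.
move=> /(congr1 (val : dcommT -> B)).
have vp (P : pred 'I_m) (F : 'I_m -> C) :
    \val (\prod_(j | P j) F j) = \prod_(j | P j) \val (F j).
  exact: (rmorph_prod (\val : {rmorphism dcommT -> B})).
rewrite vp (rmorph_sum (\val : {rmorphism dcommT -> B})) /= => ->.
apply: eq_bigr => i _.
rewrite [LHS](rmorphM (\val : {rmorphism dcommT -> B})) /= !vp; congr (_ * _).
by apply: eq_bigr => j /negPf ij /=; rewrite /g' eq_sym ij.
Qed.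

End DoubleCommutant.

Lemma prod_rev_comm (B : pzRingType) (T : Type) (w : seq T) (P : pred T) (F : T -> B) :
  (forall i j, P i -> P j -> GRing.comm (F i) (F j)) ->
  \prod_(j <- rev w | P j) F j = \prod_(j <- w | P j) F j.
Proof.
move=> FC; elim: w => [|p w IH]; first by rewrite !big_nil.
rewrite rev_cons big_rcons big_cons /= IH; case: ifP => Pp; last by rewrite mulr1.
by apply/commr_sym/commr_prod => j Pj; exact: FC.
Qed.

Lemma cdet_expand_last_nat (B : pzRingType) (I : eqType) (E : I -> I -> B) N
    (c d : nat -> I) (w : nat -> B) :
  cdet E (fun r : 'I_N.+1 => c r) (fun r => d r) (fun r => w r) =
  \sum_(j < N.+1) (-1) ^+ (N + j) *
    (cdet E (fun r : 'I_N => c (bump j r)) (fun r => d r) (fun r => w r) *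
     Lop E (w N) (c j) (d N)).
Proof.
rewrite cdet_expand_last; apply: eq_bigr => j _; congr (_ * (_ * _)).
have bN (r : 'I_N) : bump N r = r :> nat by rewrite /bump leqNgt ltn_ord.
by congr cdet; apply: boolp.funext => r /=; rewrite ?bN.
Qed.

Lemma cdet0 (B : pzRingType) (I : eqType) (E : I -> I -> B) (c d : 'I_0 -> I) w :
  cdet E c d w = 1.
Proof.
rewrite /cdet (big_pred1 (1%g : 'S_0)) => [|s]; first by rewrite odd_perm1 mul1r big_ord0.
by apply/esym/eqP/permP => -[].
Qed.

(** * Quantum minors modulo the left ideal J *)

Section GLBase.
Variables (B : pzRingType) (I : eqType) (E : I -> I -> B) (lo : nat -> I) (m : nat).
Hypothesis Egl : gl_relations E.
Hypothesis lo_inj : forall i j, (i < m)%N -> (j < m)%N -> lo i = lo j -> i = j.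

Definition hwt j := E (lo j) (lo j) - j%:R.

Lemma lo_eq i j : (i < m)%N -> (j < m)%N -> (lo i == lo j) = (i == j).
Proof. by move=> im jm; apply/eqP/eqP => [|-> //]; exact: lo_inj. Qed.

Lemma E_comm x y z t : y != z -> x != t -> GRing.comm (E x y) (E z t).
Proof.
by move=> /negPf yz /negPf xt; apply/eqP; rewrite -subr_eq0 Egl yz xt subr0.
Qed.

Lemma hwt_comm_E j x y : x != lo j -> y != lo j -> GRing.comm (hwt j) (E x y).
Proof.
move=> xj yj; apply: commr_sym; apply: commrB; last exact: commr_nat.
by apply: E_comm => //; rewrite eq_sym.
Qed.

Lemma hwt_comm i j : (i < m)%N -> (j < m)%N -> GRing.comm (hwt i) (hwt j).
Proof.
move=> im jm; have [->//|ij] := eqVneq i j.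
apply: commrB; last exact: commr_nat.
by apply: hwt_comm_E; rewrite lo_eq // eq_sym.
Qed.

Lemma hwt_mulEl j y : y != lo j -> hwt j * E (lo j) y = E (lo j) y * (hwt j + 1).
Proof.
move=> yj; have /eqP := Egl (lo j) (lo j) (lo j) y.
rewrite eqxx mulr1n [lo j == y]eq_sym (negPf yj) subr0 subr_eq => /eqP e.
by rewrite /hwt mulrBl e -(commr_nat (E _ _) j); non_commutative_ring.
Qed.

Lemma hwt_mulEr j x : x != lo j -> hwt j * E x (lo j) = E x (lo j) * (hwt j - 1).
Proof.
move=> xj; have /eqP := Egl (lo j) (lo j) x (lo j).
rewrite eqxx mulr1n [lo j == x]eq_sym (negPf xj) sub0r subr_eq => /eqP e.
by rewrite /hwt mulrBl e -(commr_nat (E _ _) j); non_commutative_ring.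
Qed.

End GLBase.

Section Evaluation.
Variables (B : pzRingType) (I : eqType) (E : I -> I -> B) (lo : nat -> I) (m : nat).
Hypothesis Egl : gl_relations E.
Hypothesis lo_inj : forall i j, (i < m)%N -> (j < m)%N -> lo i = lo j -> i = j.
Variables (J : B -> Prop).
Hypothesis J0 : J 0.
Hypothesis JB : forall x y, J x -> J y -> J (x - y).
Hypothesis JM : forall x y, J y -> J (x * y).
Hypothesis JE : forall i j, (i < j < m)%N -> J (E (lo i) (lo j)).
Variables (U : B) (b : I).
Hypothesis UC : central U.
Hypothesis b_hi : forall i, (i < m)%N -> b != lo i.

Local Notation h := (hwt E lo).
(** The value of [yev j] at [U = 1 - h i] is [h i - h j]. *)
Definition yev j := - (U - 1 + h j).

Definition rho p x i := if (i < p)%N then lo i else x.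
(** With b in front, the last column of the minor of size p + 1 is [lo (p - 1)], and removing it
    leaves a minor of the same shape. *)
Definition bcols i := if i is i'.+1 then lo i' else b.

Lemma JD x y : J x -> J y -> J (x + y).
Proof. by move=> Jx Jy; rewrite -[y]opprK -[- y]sub0r; apply: JB => //; exact: JB. Qed.

Lemma central_comm x : GRing.comm U x. Proof. exact: UC. Qed.

Lemma yev_comm_E j x y : x != lo j -> y != lo j -> GRing.comm (yev j) (E x y).
Proof.
move=> xj yj; apply/commr_sym/commrN/commrD; last by apply/commr_sym/hwt_comm_E.
by apply: commrB; [apply/commr_sym/central_comm|exact: commr1].
Qed.

Lemma yev_comm i j : (i < m)%N -> (j < m)%N -> GRing.comm (yev i) (yev j).
Proof.
move=> im jm; apply/commrN/commr_sym/commrN/commrD.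
  by apply/commrB; [apply/commr_sym/central_comm|exact: commr1].
apply/commr_sym/commrD; last exact: (hwt_comm Egl lo_inj).
by apply/commrB; [apply/commr_sym/central_comm|exact: commr1].
Qed.

(** J is only a left ideal: the induction needs the congruence to survive right
    multiplication by elements [z] through which the generators can be moved. *)
Lemma cdet_mod_J p x z : (p <= m)%N ->
  (forall i, (i < p)%N -> x != lo i) ->
  (forall i j, (i < j < p)%N -> GRing.comm (E (lo i) (lo j)) z) ->
  J ((cdet E (fun r : 'I_p.+1 => rho p x r) (fun r => bcols r) (fun r => U - r%:R)
      - ((U * \prod_(j < p) yev j) *+ (x == b) + chain lo E yev b (iota 0 p) x)) * z).
Proof.
elim: p x z => [|p IH] x z pm xlo zC.
  rewrite (cdet_expand_last_nat E 0 (rho 0 x) bcols (fun r => U - r%:R)) big_ord1.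
  rewrite big_ord0 mulr1 expr0 mul1r /=.
  by rewrite cdet0 mul1r /Lop subr0 [E x b + _]addrC subrr mul0r.
have pm' := ltnW pm.
have -> : iota 0 p.+1 = rcons (iota 0 p) p by rewrite -addn1 iotaD cats1.
rewrite (cdet_expand_last_nat E p.+1 (rho p.+1 x) bcols (fun r => U - r%:R)) !big_ord_recr /=.
set S := \sum_(j < p) _.
(* Because b occupies the first place, column [lo p] has parameter U - (p + 1), while h_p = E_pp - p
   absorbs only p; this is the origin of the -1 in [yev]. *)
have -> : Lop E (U - p.+1%:R) (rho p.+1 x p) (lo p) = - yev p.
  rewrite /Lop /rho ltnSn eqxx mulr1n /yev opprK /hwt -natr1.
  non_commutative_ring.
have -> : Lop E (U - p.+1%:R) (rho p.+1 x p.+1) (lo p) = E x (lo p).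
  by rewrite /Lop /rho ltnn (negPf (xlo p _)) // addr0.
rewrite (_ : (fun r : 'I_p.+1 => rho p.+1 x (bump p r)) =
  (fun r : 'I_p.+1 => rho p x r)); last first.
  apply: boolp.funext => r; rewrite /rho /bump; case: (ltnP r p) => rp.
    by rewrite add0n ltnS ltnW.
  by rewrite add1n ltnS ltnNge rp.
rewrite (_ : (fun r : 'I_p.+1 => rho p.+1 x (bump p.+1 r)) =
  (fun r : 'I_p.+1 => rho p (lo p) r)); last first.
  apply: boolp.funext => r; rewrite /rho /bump [(p.+1 <= r)%N]leqNgt ltn_ord add0n ltn_ord.
  by have := ltn_ord r; rewrite ltnS leq_eqVlt => /orP[/eqP ->|->//]; rewrite ltnn.
set Kx := cdet E (rho p x) _ _; set Kp := cdet E (rho p (lo p)) _ _.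
have -> : (-1) ^+ (p.+1 + p) = -1 :> B.
  by rewrite -signr_odd oddD /= addNb addbb.
have -> : (-1) ^+ (p.+1 + p.+1) = 1 :> B by rewrite -signr_odd oddD addbb.
have y_hi j : (j < p)%N -> (j < m)%N by move=> jp; apply: leq_trans jp pm'.
rewrite chain_rcons; last 2 first.
- move=> j; rewrite mem_iota => /= jp; apply: yev_comm_E; first exact/xlo/ltnW.
  by rewrite (lo_eq lo_inj) // ?y_hi // gtn_eqF.
- by move=> j; rewrite mem_iota => /= jp; apply: yev_comm => //; exact: y_hi.
pose t x := (U * \prod_(j < p) yev j) *+ (x == b) + chain lo E yev b (iota 0 p) x.
rewrite (_ : (_ - _) * z = S * z + (Kp - t (lo p)) * (E x (lo p) * z) + (Kx - t x) * (yev p * z)); last first.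
  rewrite /t [lo p == b]eq_sym (negPf (b_hi pm)) mulr0n.
  by case: (x == b); rewrite ?mulr0n ?mulr1n; non_commutative_ring.
apply: JD; first apply: JD.
- rewrite /S mulr_suml; elim/big_rec: _ => // j K _ JK; apply: JD => //.
  rewrite -mulrA; apply: (JM); rewrite -mulrA; apply: (JM).
  have jp := ltn_ord j; rewrite /Lop /rho ltnS (ltnW jp) (lo_eq lo_inj) // ?y_hi //.
  rewrite ltn_eqF // addr0 zC ?jp ?ltnSn //; apply: (JM); apply: JE.
  by rewrite jp.
- apply: (IH (lo p) (E x (lo p) * z)) => // [i ip|i j /andP[ij jp]].
    by rewrite (lo_eq lo_inj) // ?y_hi // gtn_eqF.
  apply: commrM; last by apply: zC; rewrite ij ltnW.
  apply: E_comm => //; first by rewrite eq_sym; apply: xlo; exact: ltnW.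
  by rewrite (lo_eq lo_inj) // ?y_hi ?(ltn_trans ij) // ltn_eqF // (ltn_trans ij).
- apply: (IH x (yev p * z)) => // [i ip|i j /andP[ij jp]]; first by apply: xlo; exact: ltnW.
  have ip := ltn_trans ij jp.
  apply: commrM; last by apply: zC; rewrite ij ltnW.
  by apply/commr_sym/yev_comm_E; rewrite (lo_eq lo_inj) // ?y_hi // ltn_eqF.
Qed.

End Evaluation.

Lemma prod_eq0 (B : pzRingType) (T : eqType) (w : seq T) (P : pred T) (F : T -> B) i :
  i \in w -> P i -> F i = 0 -> \prod_(j <- w | P j) F j = 0.
Proof.
move=> iw Pi Fi; elim: w iw => [//|j w IH]; rewrite inE big_cons.
case/predU1P => [<-|/IH ->]; first by rewrite Pi Fi mul0r.
by rewrite mulr0 if_same.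
Qed.

(** * Interpolation and factorization of the minor modulo J *)

Section Main.
Variables (B : pzRingType) (I : eqType) (E : I -> I -> B) (lo : nat -> I) (m : nat).
Hypothesis Egl : gl_relations E.
Hypothesis lo_inj : forall i j, (i < m)%N -> (j < m)%N -> lo i = lo j -> i = j.
Variables (J : B -> Prop).
Hypothesis J0 : J 0.
Hypothesis JB : forall x y, J x -> J y -> J (x - y).
Hypothesis JM : forall x y, J y -> J (x * y).
Hypothesis JE : forall i j, (i < j < m)%N -> J (E (lo i) (lo j)).
Variables (U : B) (a b : I).
Hypothesis UC : central U.
Hypothesis a_hi : forall i, (i < m)%N -> a != lo i.
Hypothesis b_hi : forall i, (i < m)%N -> b != lo i.

Local Notation h := (hwt E lo).
Local Notation y := (yev E lo U).
Local Notation hd i := (fun j => h i - h j).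

Lemma chain_sum_sets (f : nat -> B) :
  (forall i j, (i < m)%N -> (j < m)%N -> GRing.comm (f i) (f j)) ->
  chain lo E f b (iota 0 m) a = \sum_(W : {set 'I_m})
    path_prod lo E b [seq val j | j <- enum 'I_m & j \in W] a *
    \prod_(j < m | j \notin W) f j.
Proof.
move=> fC; rewrite -val_enum_ord -sum_path_chain ?enum_uniq //.
apply: eq_big => [W|W _].
  by apply/subsetP => j _; rewrite inE mem_enum.
rewrite prod_rev_comm ?enumT //=.
by move=> i j _ _; apply: fC.
Qed.

Lemma hwt_diff_comm i p q : (i < m)%N -> (p < m)%N -> (q < m)%N ->
  GRing.comm (h i - h p) (h i - h q).
Proof.
by move=> im pm qm; apply: commrB; apply/commr_sym/commrB; apply: (hwt_comm Egl lo_inj).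
Qed.

(** Since y_j = s - h_j at s = 1 - U, each product over omitted indices is interpolated at the nodes
    h_i. The empty subset gives a product of degree m, too large for m nodes, and stays as the
    separate term with E_ab. *)
Lemma chain_lagrange (g : 'I_m -> 'I_m -> B) :
  (forall i j : 'I_m, i != j -> (h i - h j) * g i j = 1) ->
  (forall i j : 'I_m, i != j -> g i j * (h i - h j) = 1) ->
  chain lo E y b (iota 0 m) a = E a b * \prod_(j < m) y j +
    \sum_(i < m) chain lo E (hd i) b (iota 0 m) a * \prod_(j < m | j != i) (y j * g i j).
Proof.
move=> gr gl; rewrite chain_sum_sets; last by move=> i j im jm; apply: (yev_comm Egl lo_inj).
rewrite (bigD1 set0) //=; congr (_ + _).
  congr (_ * _); last by apply: eq_bigl => j; rewrite inE.
  rewrite (_ : [seq _ | _ <- _ & _] = [::]) //.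
  by rewrite (eq_filter (a2 := pred0)) ?filter_pred0 // => j; rewrite /= inE.
pose p W := path_prod lo E b [seq val j | j <- enum 'I_m & j \in (W : {set 'I_m})] a.
transitivity (\sum_(W : {set 'I_m} | W != set0) \sum_(i < m)
    p W * (\prod_(j | j \notin W) (h i - h j)) * \prod_(j | j != i) (y j * g i j)).
  apply: eq_bigr => W W0; rewrite -/(p W).
  pose S x := (exists j : 'I_m, x = h j) \/ x = 1 - U.
  have SC s t : S s -> S t -> GRing.comm s t.
    have cU x : GRing.comm (1 - U) x.
      by apply/commr_sym/commrB; [exact: commr1|exact/commr_sym/UC].
    move=> [[i ->]|->] [[j ->]|->] //; first exact: (hwt_comm Egl lo_inj).
    exact/commr_sym/cU.
  have yE j : y j = 1 - U - h j by rewrite /yev opprD opprB.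
  under eq_bigr do rewrite yE.
  rewrite (lagrange_dcomm SC gr gl _ _ W0); first last.
  - by right.
  - by move=> j; left; exists j.
  rewrite mulr_sumr; apply: eq_bigr => i _; rewrite mulrA; congr (_ * _).
  by apply: eq_bigr => j _; rewrite yE.
rewrite exchange_big /=; apply: eq_bigr => i _; rewrite -mulr_suml; congr (_ * _).
rewrite chain_sum_sets; last by move=> s t sm tm; apply: hwt_diff_comm.
rewrite [RHS](bigD1 set0) //= [X in _ * X](_ : _ = 0) ?mulr0 ?add0r //.
by apply: (prod_eq0 (i := i)); rewrite ?mem_index_enum ?inE ?subrr.
Qed.

(** Two shifts by one cancel: cutting at i turns y into y + 1 in the first part, and this is the
    form that [chain_transp_rev] gives to a raising operator with unshifted y. *)
Lemma chain_factor i : (i < m)%N ->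
  chain lo E (hd i) b (iota 0 m) a =
  chain lo (transp E) (hd i) (lo i) (rev (iota 0 i)) b *
  chain lo E (hd i) (lo i) (iota i.+1 (m - i.+1)) a.
Proof.
move=> im; have -> : iota 0 m = iota 0 i ++ i :: iota i.+1 (m - i.+1).
  have em : m = (i + (m - i.+1).+1)%N by lia.
  by rewrite {1}em iotaD.
have lt_m p : (p < i)%N -> (p < m)%N by move=> pi; apply: ltn_trans im.
rewrite chain_split ?subrr //; last first.
  move=> p; rewrite mem_iota add0n => /= pi; apply: chain_shift.
  - move=> t; rewrite inE => t_hi.
    have [ti tp] : t != lo i /\ t != lo p.
      case/predU1P: t_hi => [->|/mapP[q]]; first by split; apply: a_hi => //; exact: lt_m.
      rewrite mem_iota => iq ->.
      by split; rewrite (lo_eq lo_inj); lia.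
    rewrite mulrDl mulrBl (hwt_mulEr Egl ti) (hwt_comm_E Egl tp); last first.
      by rewrite (lo_eq lo_inj); lia.
    non_commutative_ring.
  - move=> q; rewrite mem_iota => iq t; rewrite inE => t_hi.
    have [ti tp] : t != lo i /\ t != lo p.
      case/predU1P: t_hi => [->|/mapP[r]]; first by split; apply: a_hi => //; exact: lt_m.
      rewrite mem_iota => ir ->.
      by split; rewrite (lo_eq lo_inj); lia.
    apply/commr_sym/commrB; apply/commr_sym/(hwt_comm_E Egl) => //;
      by rewrite (lo_eq lo_inj); lia.
  - by move=> q; rewrite mem_iota => iq; apply: hwt_diff_comm; lia.
congr (_ * _); rewrite chain_transp_rev ?revK //.
- by apply/mapP => -[p]; rewrite mem_rev mem_iota => pi /lo_inj ip; have := ip im (lt_m _ pi); lia.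
- exact: b_hi.
- apply/mapP => -[p]; rewrite mem_rev mem_iota => pi /eqP.
  by rewrite (negPf (b_hi (lt_m _ pi))).
- rewrite map_inj_in_uniq ?rev_uniq ?iota_uniq // => p q.
  by rewrite !mem_rev !mem_iota => /lt_m pm /lt_m qm; exact: lo_inj.
- move=> p q; rewrite !mem_rev !mem_iota => /lt_m pm /lt_m qm.
  exact: hwt_diff_comm.
- move=> p q; rewrite !mem_rev !mem_iota => /= pi qi pq t tw tp.
  have ti : t != lo i.
    move: tw; rewrite inE => /predU1P[->|/mapP[r]]; first exact: b_hi.
    by rewrite mem_rev mem_iota => ri ->; rewrite (lo_eq lo_inj); lia.
  apply/commr_sym/commrB; apply/commr_sym/(hwt_comm_E Egl) => //; last by rewrite eq_sym.
  by rewrite (lo_eq lo_inj); lia.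
Qed.

Theorem cdet_mod_J_formula (g : 'I_m -> 'I_m -> B) : torsion_free B ->
  (forall i j : 'I_m, i != j -> (h i - h j) * g i j = 1) ->
  (forall i j : 'I_m, i != j -> g i j * (h i - h j) = 1) ->
  J (cdet E (fun r : 'I_m.+1 => rho lo m a r) (fun r => rho lo m b r) (fun r => U - r%:R)
    - (-1) ^+ m * ((U *+ (a == b) + E a b) * \prod_(j < m) y j +
      \sum_(i < m) chain lo (transp E) (hd i) (lo i) (rev (iota 0 i)) b *
        chain lo E (hd i) (lo i) (iota i.+1 (m - i.+1)) a *
        \prod_(j < m | j != i) (y j * g i j))).
Proof.
move=> Btf gr gl.
have JE' := cdet_mod_J Egl lo_inj J0 JB JM JE UC b_hi (x := a) (z := 1) (leqnn m) a_hi
  (fun i j _ => commr1 _).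
(* This cycle moves the column b from the first place back to the last; its sign is (-1)^m. *)
have -> : (fun r : 'I_m.+1 => rho lo m b r) =
    (fun r : 'I_m.+1 => bcols lo b r) \o lift_perm ord_max ord0 1%g.
  apply: boolp.funext => r /=; rewrite /rho.
  case: (unliftP ord_max r) => [r'|] ->; last by rewrite lift_perm_id ltnn.
  by rewrite lift_perm_lift perm1 lift_max ltn_ord.
rewrite cdet_perm //; first last.
- by move=> i j ->; rewrite -natr1 opprD addrA.
- move=> i x; apply/commr_sym/commrB; first exact/commr_sym/UC.
  exact: commr_nat.
rewrite odd_lift_perm odd_perm1 /= addbF addbF signr_odd -mulrBr.
apply: JM; move: JE'; rewrite mulr1 (chain_lagrange gr gl).
rewrite mulrDl -mulrnAl addrA.
rewrite (eq_bigr _ (fun i (_ : true) => congr1 (fun c => c *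
  \prod_(j < m | j != i) (y j * g i j)) (chain_factor (ltn_ord i)))).
by [].
Qed.

End Main.

(** * The two formulas for an abstract family, and duality *)

Lemma chain_map (B : pzRingType) (I : eqType) (lo : nat -> I) (f : nat -> nat)
    (E : I -> I -> B) (y : nat -> B) x w z :
  chain (lo \o f) E (y \o f) x w z = chain lo E y x (map f w) z.
Proof. by elim: w x => //= p w IH x; rewrite !IH. Qed.

Lemma prod_opp_neq (B : pzRingType) m (i : 'I_m) (F : 'I_m -> B) :
  \prod_(j < m | j != i) - F j = (-1) ^+ m.-1 * \prod_(j < m | j != i) F j.
Proof. by have := prodrN (predC1 i) F; rewrite cardC1 card_ord. Qed.

(** The operator s_ib for an abstract family, so that duality can exchange it with [lowering]; for
    A' it is [raiseA], as shown below. *)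
Definition raising (B : pzRingType) (I : eqType) (E : I -> I -> B) (lo : nat -> I) i b :=
  chain lo (transp E) (fun j => hwt E lo i - hwt E lo j) (lo i) (rev (iota 0 i)) b.

Definition lowering (B : pzRingType) (I : eqType) (E : I -> I -> B) (lo : nat -> I) m i a :=
  chain lo E (fun j => hwt E lo i - hwt E lo j) (lo i) (iota i.+1 (m - i.+1)) a.

Lemma prod_rev_ord (B : pzRingType) m (P : pred 'I_m) (F : 'I_m -> B) :
  (forall i j, P i -> P j -> GRing.comm (F i) (F j)) ->
  \prod_(j < m | P (rev_ord j)) F (rev_ord j) = \prod_(j < m | P j) F j.
Proof.
have e : [seq rev_ord j | j <- enum 'I_m] = rev (enum 'I_m).
  apply: (inj_map val_inj); rewrite -map_comp map_rev val_enum_ord.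
  apply: (@eq_from_nth _ 0%N) => [|j]; rewrite size_map ?size_rev size_enum_ord ?size_iota //.
  move=> jm; rewrite nth_rev size_iota // nth_iota; last by lia.
  by rewrite (nth_map (Ordinal jm)) ?size_enum_ord //= nth_enum_ord.
move=> FC; rewrite -(big_map (@rev_ord m) P F) /index_enum -enumT e.
exact: prod_rev_comm.
Qed.

Section Formulas.
Variables (B : pzRingType) (I : eqType) (E : I -> I -> B) (lo : nat -> I) (m : nat).
Hypothesis Btf : torsion_free B.
Hypothesis Egl : gl_relations E.
Hypothesis lo_inj : forall i j, (i < m)%N -> (j < m)%N -> lo i = lo j -> i = j.
Variables (J : B -> Prop).
Hypothesis J0 : J 0.
Hypothesis JB : forall x y, J x -> J y -> J (x - y).
Hypothesis JM : forall x y, J y -> J (x * y).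
Hypothesis JE : forall i j, (i < j < m)%N -> J (E (lo i) (lo j)).
Variables (U : B) (a b : I).
Hypothesis UC : central U.
Hypothesis a_hi : forall i, (i < m)%N -> a != lo i.
Hypothesis b_hi : forall i, (i < m)%N -> b != lo i.

Local Notation h := (hwt E lo).

Variable g : 'I_m -> 'I_m -> B.
Hypothesis gr : forall i j : 'I_m, i != j -> (h i - h j) * g i j = 1.
Hypothesis gl : forall i j : 'I_m, i != j -> g i j * (h i - h j) = 1.

Definition qminor := cdet E (fun r : 'I_m.+1 => rho lo m a r)
  (fun r => rho lo m b r) (fun r => U - r%:R).

Lemma qminor_raise_lower :
  J (qminor - ((U *+ (a == b) + E a b) * \prod_(j < m) (U + h j - 1) -
    \sum_(i < m) raising E lo i b * lowering E lo m i a *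
      \prod_(j < m | j != i) ((U + h j - 1) * g i j))).
Proof.
have := cdet_mod_J_formula Egl lo_inj J0 JB JM JE UC a_hi b_hi Btf gr gl.
rewrite -/qminor; congr (J (_ - _)).
have yE j : yev E lo U j = - (U + h j - 1) by rewrite /yev addrAC.
rewrite mulrDr mulr_sumr; congr (_ + _).
  under eq_bigr do rewrite yE.
  rewrite prodrN card_ord mulrA -(commr_sign _ m) -mulrA.
  by rewrite [X in _ * X]mulrA -signr_odd -signr_addb addbb mul1r.
rewrite -sumrN; apply: eq_bigr => i _.
rewrite -/(raising E lo i b) -/(lowering E lo m i a).
under eq_bigr do rewrite yE mulNr.
rewrite prod_opp_neq [X in _ * X]mulrA (commr_sign _ m.-1) -mulrA [LHS]mulrA.
rewrite -exprD (_ : (-1) ^+ (m + m.-1) = -1) ?mulN1r //.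
have -> : (m + m.-1 = (m.-1 + m.-1).+1)%N by have := ltn_ord i; lia.
by rewrite -signr_odd /= oddD addbb.
Qed.

End Formulas.

(** [qminor_raise_lower] is applied to [E'], [lo'], which again satisfy the
    relations of gl and have the same left ideal J. *)
Section FormulaLowerRaise.
Variables (B : pzRingType) (I : eqType) (E : I -> I -> B) (lo : nat -> I) (m : nat).
Hypothesis Btf : torsion_free B.
Hypothesis Egl : gl_relations E.
Hypothesis lo_inj : forall i j, (i < m)%N -> (j < m)%N -> lo i = lo j -> i = j.
Variables (J : B -> Prop).
Hypothesis J0 : J 0.
Hypothesis JB : forall x y, J x -> J y -> J (x - y).
Hypothesis JM : forall x y, J y -> J (x * y).
Hypothesis JE : forall i j, (i < j < m)%N -> J (E (lo i) (lo j)).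
Variables (U : B) (a b : I).
Hypothesis UC : central U.
Hypothesis a_hi : forall i, (i < m)%N -> a != lo i.
Hypothesis b_hi : forall i, (i < m)%N -> b != lo i.

Local Notation h := (hwt E lo).

Variable g : 'I_m -> 'I_m -> B.
Hypothesis gr : forall i j : 'I_m, i != j -> (h i - h j) * g i j = 1.
Hypothesis gl : forall i j : 'I_m, i != j -> g i j * (h i - h j) = 1.

Local Notation E' := (fun x y => - E y x).
Local Notation rv := (fun j => m - j.+1)%N.
Local Notation lo' := (lo \o rv).

(** The constant is the sum of j and its mirror image; it drops out of differences, which only
    change sign. *)
Lemma hwt_dual j : (j < m)%N -> hwt E' lo' j = - h (rv j) - m.-1%:R.
Proof.
move=> jm; rewrite /hwt /=; have -> : m.-1 = (rv j + j)%N by lia.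
rewrite natrD; non_commutative_ring.
Qed.

Lemma hwtB_dual i j : (i < m)%N -> (j < m)%N ->
  hwt E' lo' i - hwt E' lo' j = - (h (rv i) - h (rv j)).
Proof. by move=> im jm; rewrite !hwt_dual //; non_commutative_ring. Qed.

Lemma eq_chain (y y' : nat -> B) (F : I -> I -> B) (l : nat -> I) x w z :
  {in w, y =1 y'} -> chain l F y x w z = chain l F y' x w z.
Proof.
elim: w x => //= p w IH x yy'; rewrite !IH ?yy' ?mem_head //;
  by move=> q qw; rewrite yy' // inE qw orbT.
Qed.

Lemma raising_dual (i : 'I_m) c :
  raising E' lo' i c = (-1) ^+ i.+1 * lowering E lo m (rv i) c.
Proof.
rewrite /raising /lowering.
rewrite (@eq_chain _ (fun j => - (h (rv i) - h (rv j)))); last first.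
  move=> j; rewrite mem_rev mem_iota => ji; rewrite hwtB_dual //.
  by have := ltn_ord i; lia.
rewrite chain_opp size_rev size_iota; congr (_ * _).
rewrite (chain_map lo rv E (fun j => h (rv i) - h j)) map_rev; congr chain.
apply: (@eq_from_nth _ 0%N) => [|j]; rewrite size_rev size_map !size_iota.
  by have := ltn_ord i; lia.
move=> ji; have im := ltn_ord i.
rewrite nth_rev size_map size_iota // (nth_map 0%N) ?size_iota ?nth_iota; lia.
Qed.

Lemma lowering_dual (i : 'I_m) c :
  lowering E' lo' m i c = (-1) ^+ (m - i) * raising E lo (rv i) c.
Proof.
rewrite /raising /lowering; have im := ltn_ord i.
rewrite (@eq_chain _ (fun j => - (h (rv i) - h (rv j)))); last first.
  by move=> j; rewrite mem_iota => ji; rewrite hwtB_dual //; lia.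
rewrite chain_opp size_iota subnSK //; congr (_ * _).
rewrite (chain_map lo rv (transp E) (fun j => h (rv i) - h j)); congr chain.
apply: (@eq_from_nth _ 0%N) => [|j]; rewrite size_map ?size_rev !size_iota //.
move=> ji; rewrite nth_rev size_iota // (nth_map 0%N) ?size_iota ?nth_iota; lia.
Qed.

(** Reversing and negating the parameters U, ..., U - m gives a sequence starting at m - U. The
    mirror permutation then acts on both rows and columns, so its signs cancel. *)
Lemma qminor_dual : qminor E lo m U a b = (-1) ^+ m.+1 * qminor E' lo' m (m%:R - U) b a.
Proof.
rewrite /qminor cdet_opp_transpose //; first last.
- by move=> i j ->; rewrite -natr1 opprD addrA.
- by move=> i x; apply/commr_sym/commrB; [exact/commr_sym/UC|exact: commr_nat].
have rhoE c : (fun r : 'I_m.+1 => rho lo m c r) =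
    (fun r : 'I_m.+1 => rho lo' m c r) \o lift_perm ord_max ord_max (perm (@rev_ord_inj m)).
  apply: boolp.funext => r /=; rewrite /rho.
  case: (unliftP ord_max r) => [r'|] ->; last by rewrite lift_perm_id ltnn.
  rewrite lift_perm_lift permE !lift_max !ltn_ord /=; congr lo; rewrite /=.
  have r'm : (r' < m)%N by exact: ltn_ord.
  by rewrite subnSK // subKn // ltnW.
set w' := (fun r : 'I_m.+1 => m%:R - U - r%:R).
have -> : (fun r : 'I_m.+1 => - (U - (rev_ord r)%:R)) = w'.
  apply: boolp.funext => r; rewrite /w' /=; have rm : (r <= m)%N by rewrite -ltnS.
  by rewrite subSS natrB //; non_commutative_ring.
rewrite !rhoE cdet_row_perm cdet_perm //; first last.
- by move=> i j ji; rewrite /w' ji -natr1 opprD addrA.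
- move=> i x; apply/commr_sym/commrB; last exact: commr_nat.
  by apply: commrB; [exact: commr_nat|exact/commr_sym/UC].
- exact: gl_relations_opp_transpose.
by congr (_ * _); rewrite mulrA -signr_addb addbb mul1r.
Qed.

Lemma qminor_lower_raise :
  J (qminor E lo m U a b - (((U - m%:R) *+ (a == b) + E a b) * \prod_(j < m) (U + h j) -
    \sum_(i < m) lowering E lo m i a * raising E lo i b *
      \prod_(j < m | j != i) ((U + h j) * g i j))).
Proof.
have Egl' := gl_relations_opp_transpose Egl.
have lo'_inj i j : (i < m)%N -> (j < m)%N -> lo' i = lo' j -> i = j.
  by move=> im jm /lo_inj; lia.
have JE' i j : (i < j < m)%N -> J (E' (lo' i) (lo' j)).
  by move=> ijm; rewrite -sub0r; apply: JB => //; apply: JE; lia.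
have UC' : central (m%:R - U).
  by move=> x; apply/commr_sym/commrB; [exact: commr_nat|exact/commr_sym/UC].
have a_hi' i : (i < m)%N -> a != lo' i by move=> im; apply: a_hi; lia.
have b_hi' i : (i < m)%N -> b != lo' i by move=> im; apply: b_hi; lia.
pose g' i j := - g (rev_ord i) (rev_ord j).
have gr' (i j : 'I_m) : i != j -> (hwt E' lo' i - hwt E' lo' j) * g' i j = 1.
  move=> ij; rewrite hwtB_dual // mulrNN; apply: (gr (i := rev_ord i) (j := rev_ord j)).
  by rewrite (inj_eq rev_ord_inj).
have gl' (i j : 'I_m) : i != j -> g' i j * (hwt E' lo' i - hwt E' lo' j) = 1.
  move=> ij; rewrite hwtB_dual // mulrNN; apply: (gl (i := rev_ord i) (j := rev_ord j)).
  by rewrite (inj_eq rev_ord_inj).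
have := qminor_raise_lower Btf Egl' lo'_inj J0 JB JM JE' UC' b_hi' a_hi' gr' gl'.
move=> /(JM ((-1) ^+ m.+1)); rewrite mulrBr -qminor_dual; congr (J (_ - _)).
(* The -(m - 1) of [hwt_dual] cancels m - 1: this is why h_j - 1 in one formula becomes h_j in the
   other. *)
have yE (j : 'I_m) : m%:R - U + hwt E' lo' j - 1 = - (U + h (rv j)).
  rewrite hwt_dual //; have e : m%:R = m.-1%:R + 1 :> B.
    by rewrite natr1 prednK //; have := ltn_ord j; lia.
  rewrite e; non_commutative_ring.
(* The mirror image reverses the ordered products; their factors, inverses included, commute because
   they lie in the double commutant of [S]. *)
pose S x := (exists j : 'I_m, x = h j) \/ x = U.
have SC s t : S s -> S t -> GRing.comm s t.
  move=> [[i ->]|->] [[j ->]|->]; [exact: (hwt_comm Egl lo_inj)| | |]; try exact: UC.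
  exact/commr_sym/UC.
have hD (j : 'I_m) : h j \in dcomm S by apply: dcomm_gen; left; exists j.
have UD : U \in dcomm S by apply: dcomm_gen; right.
have gD (i j : 'I_m) : i != j -> g i j \in dcomm S.
  by move=> ij; apply: (dcomm_inv _ (gr ij) (gl ij)); exact: rpredB.
have sE (x y z : B) k l r : (-1) ^+ k * x * ((-1) ^+ l * y) * ((-1) ^+ r * z) =
    (-1) ^+ (k + l + r) * (x * y * z).
  rewrite -![in LHS]mulrA (mulrA x) (commr_sign x) -!mulrA (mulrA y) (commr_sign y).
  by rewrite -!mulrA (mulrA x) (commr_sign x) !exprD !mulrA.
rewrite mulrBr; congr (_ - _).
  under eq_bigr do rewrite yE.
  rewrite prodrN card_ord (prod_rev_ord (P := predT) (F := fun j => U + h j)); last first.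
    by move=> i j _ _; apply: (dcomm_comm SC); exact: rpredD.
  have -> : (m%:R - U) *+ (b == a) + - E a b = - ((U - m%:R) *+ (a == b) + E a b).
    by rewrite opprD -mulNrn opprB eq_sym.
  rewrite mulNr mulrN -mulNr exprS mulN1r opprK (mulrA _ ((-1) ^+ m)) (commr_sign _ m) -mulrA.
  by rewrite [LHS]mulrA -signr_odd -signr_addb addbb mul1r.
rewrite mulr_sumr (reindex_inj rev_ord_inj); apply: eq_bigr => i _.
rewrite raising_dual lowering_dual.
have -> : rv (rev_ord i) = i by rewrite /=; have := ltn_ord i; lia.
have -> : \prod_(j < m | j != rev_ord i) ((m%:R - U + hwt E' lo' j - 1) * g' (rev_ord i) j) =
  (-1) ^+ 0 * \prod_(j < m | j != i) ((U + h j) * g i j).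
  rewrite mul1r -[RHS]prod_rev_ord; last first.
    move=> j k ji ki; apply: (dcomm_comm SC); apply: rpredM; try exact: rpredD.
      by apply: gD; rewrite eq_sym.
    by apply: gD; rewrite eq_sym.
  apply: eq_big => [j|j _]; first by rewrite -(inj_eq rev_ord_inj) rev_ordK.
  by rewrite yE /g' mulrNN rev_ordK.
rewrite sE mulrA -exprD (_ : (_ + _ = m.+1 + m.+1)%N).
  by rewrite -signr_odd oddD addbb mul1r.
by have := ltn_ord i; rewrite /=; lia.
Qed.

End FormulaLowerRaise.

(** * The raising and lowering operators normalize J *)

Section ChainMove.
Variables (B : pzRingType) (I : eqType) (lo : nat -> I) (F : I -> I -> B).
Variables (e : B) (y y' : nat -> B).

Lemma chain_move x w z :
  {in x :: map lo w, forall s, {in z :: map lo w, forall t, GRing.comm e (F t s)}} ->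
  {in w, forall q, e * y q = y' q * e} ->
  e * chain lo F y x w z = chain lo F y' x w z * e.
Proof.
elim: w x => [|q w IH] x eF ey /=; first by apply: eF; rewrite mem_head.
have ey' : {in w, forall q, e * y q = y' q * e}.
  by move=> r rw; apply: ey; rewrite inE rw orbT.
have sub (x' : I) s : x' \in x :: map lo (q :: w) ->
    s \in x' :: map lo w -> s \in x :: map lo (q :: w).
  by move=> x'S; rewrite inE => /predU1P[->//|sw]; rewrite !inE sw !orbT.
have sub' t : t \in z :: map lo w -> t \in z :: map lo (q :: w).
  by rewrite !inE => /orP[|] ->; rewrite ?orbT.
rewrite mulrDr mulrDl !mulrA eF ?inE ?eqxx ?orbT // -!mulrA IH //; last first.
  move=> s sS t tT; apply: eF; last exact: sub'.
  by apply: sub sS; rewrite !inE eqxx orbT.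
rewrite -(ey q) ?mem_head // !mulrA IH // => s sS t tT; apply: eF; last exact: sub'.
by apply: sub sS; rewrite mem_head.
Qed.

(** The element e fails to commute only with the factor that leaves x, where the commutator consumes
    e and restarts the path at x'; hence the unmodified y in the extra term. *)
Lemma chain_move_source x x' w z :
  {in z :: map lo w, forall t, e * F t x = F t x * e + F t x'} ->
  {in map lo w, forall s, {in z :: map lo w, forall t, GRing.comm e (F t s)}} ->
  {in w, forall q, e * y q = y' q * e} ->
  e * chain lo F y x w z = chain lo F y' x w z * e + chain lo F y x' w z.
Proof.
elim: w => [|q w IH] ex eF ey /=; first by apply: ex; rewrite mem_head.
have ey' : {in w, forall q, e * y q = y' q * e}.
  by move=> r rw; apply: ey; rewrite inE rw orbT.
have sub z' t : t \in z' :: map lo w -> t \in z' :: map lo (q :: w).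
  by rewrite !inE => /orP[|] ->; rewrite ?orbT.
have subw t : t \in map lo w -> t \in map lo (q :: w) by rewrite inE => ->; rewrite orbT.
rewrite mulrDr !mulrA ex ?inE ?eqxx ?orbT // IH //; first last.
- by move=> s /subw sS t /sub tT; exact: eF.
- by move=> t /sub; exact: ex.
rewrite mulrDl -mulrA chain_move //; last first.
  move=> s sS t /sub tT; apply: eF => //.
rewrite !mulrDl -!mulrA ey ?mem_head // !mulrA.
by rewrite -!addrA; congr (_ + _); rewrite addrCA.
Qed.
End ChainMove.

Section Normalizer.
Variables (B : pzRingType) (I : eqType) (E : I -> I -> B) (lo : nat -> I) (m : nat).
Hypothesis Egl : gl_relations E.
Hypothesis lo_inj : forall i j, (i < m)%N -> (j < m)%N -> lo i = lo j -> i = j.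
Variables (J : B -> Prop).
Hypothesis JB : forall x y, J x -> J y -> J (x - y).
Hypothesis JM : forall x y, J y -> J (x * y).
Hypothesis JE : forall i j, (i < j < m)%N -> J (E (lo i) (lo j)).

Local Notation h := (hwt E lo).

(** E_(p,q+1) is the commutator of E_pq and E_(q,q+1), and J absorbs multiplication on the left. *)
Lemma annihilated_of_adjacent x :
  (forall p, (p.+1 < m)%N -> J (E (lo p) (lo p.+1) * x)) ->
  forall p q, (p < q < m)%N -> J (E (lo p) (lo q) * x).
Proof.
move=> Jx p q /andP[pq]; rewrite -(subnKC pq).
elim: (q - p.+1)%N => [|d IH] qm; first by rewrite addn0 in qm *; exact: Jx.
set r := (p.+1 + d)%N in IH *; rewrite addnS -/r in qm *.
have /eqP := Egl (lo p) (lo r) (lo r) (lo r.+1).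
rewrite eqxx (lo_eq lo_inj) ?ltn_eqF; [|lia..].
rewrite mulr1n subr0 => /eqP <-; rewrite mulrBl -!mulrA.
by apply: JB; apply: JM; [exact: Jx|apply: IH; lia].
Qed.

Variables (b : I).
Hypothesis b_hi : forall i, (i < m)%N -> b != lo i.

(** Here E_pp - E_(p+1,p+1) = h_p - h_(p+1) - 1, and the chain leaving p raises h_p by 1, so the
    unit disappears on the right. *)
Lemma E_weight_chain (y : nat -> B) p : (p.+1 < m)%N ->
  {in rev (iota 0 p), forall q, GRing.comm (h p - h p.+1) (y q)} ->
  (E (lo p) (lo p) - E (lo p.+1) (lo p.+1)) *
    chain lo (transp E) y (lo p) (rev (iota 0 p)) b =
  chain lo (transp E) y (lo p) (rev (iota 0 p)) b * (h p - h p.+1).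
Proof.
move=> pm yC; apply: chain_shift => //.
  move=> t tS.
  have [tp tp1] : t != lo p /\ t != lo p.+1.
    move: tS; rewrite inE => /predU1P[->|/mapP[q]]; first by split; apply: b_hi; lia.
    by rewrite mem_rev mem_iota => qp ->; split; rewrite (lo_eq lo_inj); lia.
  have -> : E (lo p) (lo p) - E (lo p.+1) (lo p.+1) = h p - h p.+1 - 1.
    by rewrite /hwt -natr1; non_commutative_ring.
  have e1 := hwt_mulEl Egl tp; have e2 : h p.+1 * E (lo p) t = E (lo p) t * h p.+1.
    by apply: (hwt_comm_E Egl) => //; rewrite (lo_eq lo_inj); lia.
  move: (h p) (h p.+1) e1 e2 => u v e1 e2.
  rewrite /transp !mulrBl e1 e2; non_commutative_ring.
move=> q; rewrite mem_rev mem_iota => qp t tS.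
have [tp tp1] : t != lo p /\ t != lo p.+1.
  move: tS; rewrite inE => /predU1P[->|/mapP[r]]; first by split; apply: b_hi; lia.
  by rewrite mem_rev mem_iota => rp ->; split; rewrite (lo_eq lo_inj); lia.
by apply/commr_sym/commrB; apply/commr_sym/(hwt_comm_E Egl) => //;
  rewrite (lo_eq lo_inj); lia.
Qed.

(** Let e = E_(p,p+1). If i <= p, e passes through s_ib and only shifts the h's. Otherwise paths
    through p + 1, through p, or through both leave commutator terms, and these cancel; so e s_ib =
    X e, which lies in J. *)
Lemma adjacent_raising p i : (p.+1 < m)%N -> (i < m)%N ->
  J (E (lo p) (lo p.+1) * raising E lo i b).
Proof.
move=> pm im; set e := E (lo p) (lo p.+1).
have Je : J e by apply: JE; lia.
suff [X ->] : exists X, e * raising E lo i b = X * e by exact: JM.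
have eh q : (q < m)%N -> q != p -> q != p.+1 -> e * h q = h q * e.
  by move=> qm qp qp1; symmetry; apply: (hwt_comm_E Egl); rewrite (lo_eq lo_inj); lia.
have ehp : e * h p = (h p - 1) * e.
  rewrite mulrBl mul1r (hwt_mulEl Egl) ?mulrDr ?mulr1 ?addrK //.
  by rewrite (lo_eq lo_inj); lia.
have ehp1 : e * h p.+1 = (h p.+1 + 1) * e.
  rewrite mulrDl mul1r (hwt_mulEr Egl) ?mulrBr ?mulr1 ?subrK //.
  by rewrite (lo_eq lo_inj); lia.
have eE x t : x != lo p.+1 -> t != lo p -> GRing.comm e (E x t).
  by move=> xp tp; apply: (E_comm Egl); rewrite eq_sym.
pose y q := h i - h q.
pose d q : B := (q == p.+1)%:R - (q == p)%:R.
pose c q := y q + d i - d q.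
have ed q : (q < m)%N -> e * h q = (h q + d q) * e.
  move=> qm; rewrite /d; have [->|qp] := eqVneq q p.
    by rewrite ltn_eqF // sub0r ehp.
  have [->|qp1] := eqVneq q p.+1; first by rewrite subr0 ehp1.
  by rewrite subrr addr0 eh.
have ey q : (q < m)%N -> e * y q = c q * e.
  by move=> qm; rewrite /c /y mulrBr !ed //; non_commutative_ring.
have below k : (k <= p)%N ->
    {in b :: map lo (rev (iota 0 k)), forall t, t != lo p}.
  move=> kp t; rewrite inE => /predU1P[->|/mapP[q]]; first by apply: b_hi; lia.
  by rewrite mem_rev mem_iota => qk ->; rewrite (lo_eq lo_inj); lia.
have below1 k : (k <= p)%N ->
    {in map lo (rev (iota 0 k)), forall t, t != lo p.+1}.
  move=> kp t /mapP[q]; rewrite mem_rev mem_iota => qk ->.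
  by rewrite (lo_eq lo_inj); lia.
have eyw k : (k <= p)%N -> {in rev (iota 0 k), forall q, e * y q = c q * e}.
  by move=> kp q; rewrite mem_rev mem_iota => qk; apply: ey; lia.
pose C x k := chain lo (transp E) y x (rev (iota 0 k)) b.
pose C' x k := chain lo (transp E) c x (rev (iota 0 k)) b.
have eC x k : (k <= p)%N -> x != lo p.+1 -> e * C x k = C' x k * e.
  move=> kp xp1; apply: chain_move; last exact: eyw.
  move=> s sS t /(below _ kp) tp; apply: eE => //.
  by move: sS; rewrite inE => /predU1P[->//|]; exact: below1.
have [ip|pi] := leqP i p.
  by exists (C' (lo i) i); apply: eC => //; rewrite (lo_eq lo_inj); lia.
have p_p1 : lo p != lo p.+1 by rewrite (lo_eq lo_inj); lia.
have eCs : e * C (lo p.+1) p = C' (lo p.+1) p * e + C (lo p) p.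
  apply: chain_move_source; last exact: eyw.
    move=> t /below tp; apply/eqP; rewrite addrC -subr_eq Egl eqxx [lo p == t]eq_sym.
    by rewrite (negPf (tp _)) // subr0.
  by move=> s /below1 sp t /below tp; apply: eE; [exact: sp|exact: tp].
have wC : (E (lo p) (lo p) - E (lo p.+1) (lo p.+1)) * C (lo p) p =
    C (lo p) p * (h p - h p.+1).
  apply: E_weight_chain => // q; rewrite mem_rev mem_iota => qp.
  by apply: commrB; apply/commr_sym/commrB; apply: (hwt_comm Egl lo_inj); lia.
have eEp1p : e * E (lo p.+1) (lo p) = E (lo p.+1) (lo p) * e +
    (E (lo p) (lo p) - E (lo p.+1) (lo p.+1)).
  by apply/eqP; rewrite addrC -subr_eq Egl !eqxx.
have s1 : e * (E (lo p.+1) (lo p) * C (lo p) p + C (lo p.+1) p * y p) =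
    (E (lo p.+1) (lo p) * C' (lo p) p + C' (lo p.+1) p * c p) * e +
    C (lo p) p * (h p - h p.+1 + y p).
  rewrite mulrDr !mulrA eEp1p eCs [(_ + _) * C _ _]mulrDl wC -mulrA (eC _ _ _ p_p1) //.
  rewrite [(_ + _) * y p]mulrDl -[_ * e * y p]mulrA ey; last by lia.
  by non_commutative_ring.
(* The cancellation that makes s_ib normalize J: it is what the choice y_q = h_i - h_q achieves. For
   i = p + 1 the last term is itself 0. *)
have y_cancel : h p - h p.+1 + (y p - y p.+1) = 0.
  by rewrite /y; non_commutative_ring.
have [ip1|ip1] := eqVneq i p.+1.
  have -> : raising E lo i b = E (lo p.+1) (lo p) * C (lo p) p + C (lo p.+1) p * y p.
    by rewrite /raising /C /y ip1 -[X in iota 0 X](addn1 p) iotaD rev_cat.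
  exists (E (lo p.+1) (lo p) * C' (lo p) p + C' (lo p.+1) p * c p).
  by rewrite s1; move: y_cancel; rewrite /y ip1 subrr subr0 => ->; rewrite mulr0 addr0.
(* For i > p + 1 the unwanted terms already cancel in the tail below p + 2; prepending larger
   indices only adds factors that e passes. *)
pose w := [:: p.+1, p & rev (iota 0 p)].
suff chainP w1 x : {in w1, forall q, (p.+1 < q < m)%N} -> x != lo p.+1 ->
    exists X, e * chain lo (transp E) y x (w1 ++ w) b = X * e.
  rewrite /raising; have -> : rev (iota 0 i) = rev (iota p.+2 (i - p.+2)) ++ w.
    have ei : (i = p.+2 + (i - p.+2))%N by lia.
    by rewrite {1}ei iotaD rev_cat add0n -(addn2 p) iotaD rev_cat.
  apply: chainP => [q|]; last by rewrite (lo_eq lo_inj); lia.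
  by rewrite mem_rev mem_iota; lia.
elim: w1 x => [|q w1 IH] x w1S xp1.
  exists (E x (lo p.+1) * (E (lo p.+1) (lo p) * C' (lo p) p + C' (lo p.+1) p * c p) +
    (E x (lo p) * C' (lo p) p + C' x p * c p) * c p.+1).
  rewrite /= -/(C (lo p) p) -/(C (lo p.+1) p) -/(C x p) /transp.
  have eExp : e * E x (lo p) = E x (lo p) * e - E x (lo p.+1).
    by apply/eqP; rewrite -subr_eq0 opprB addrCA Egl eqxx [lo p.+1 == x]eq_sym (negPf xp1) sub0r subrr.
  have eExp1 : e * E x (lo p.+1) = E x (lo p.+1) * e by apply: eE => //; rewrite eq_sym.
  have s2 : e * (E x (lo p) * C (lo p) p + C x p * y p) =
      (E x (lo p) * C' (lo p) p + C' x p * c p) * e - E x (lo p.+1) * C (lo p) p.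
    rewrite mulrDr !mulrA eExp (eC _ _ _ xp1) // -[_ * e * y p]mulrA ey; last by lia.
    rewrite mulrBl -[_ * e * C _ _]mulrA (eC _ _ _ p_p1) //.
    by non_commutative_ring.
  rewrite mulrDr !mulrA eExp1 -[_ * e * (_ + _)]mulrA s1 s2.
  rewrite [(_ - _) * y p.+1]mulrBl -[_ * e * y p.+1]mulrA ey; last by lia.
  have := congr1 (fun u => E x (lo p.+1) * C (lo p) p * u) y_cancel.
  rewrite mulr0 addrA mulrBr => /subr0_eq <-.
  by non_commutative_ring.
have /andP[pq qm] : (p.+1 < q < m)%N by apply: w1S; rewrite mem_head.
have w1S' : {in w1, forall q, (p.+1 < q < m)%N}.
  by move=> r rw; apply: w1S; rewrite inE rw orbT.
have qp1 : lo q != lo p.+1 by rewrite (lo_eq lo_inj); lia.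
have [X eX] := IH x w1S' xp1; have [Y eY] := IH (lo q) w1S' qp1.
exists (E x (lo q) * Y + X * c q).
rewrite /= mulrDr !mulrA eX -[_ * e * y q]mulrA ey // /transp eE //.
  by rewrite -[_ * e * _]mulrA eY; non_commutative_ring.
by rewrite (lo_eq lo_inj); lia.
Qed.

Lemma raising_annihilated i p q : (i < m)%N -> (p < q < m)%N ->
  J (E (lo p) (lo q) * raising E lo i b).
Proof.
by move=> im; apply: annihilated_of_adjacent => r rm; exact: adjacent_raising.
Qed.

End Normalizer.

(** The dual family has the same J up to signs, and its raising operators are the lowering operators
    of [E]. *)
Lemma lowering_annihilated (B : pzRingType) (I : eqType) (E : I -> I -> B)
    (lo : nat -> I) (m : nat) (J : B -> Prop) a i p q : gl_relations E ->
  (forall i j, (i < m)%N -> (j < m)%N -> lo i = lo j -> i = j) ->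
  (forall x y, J x -> J y -> J (x - y)) ->
  (forall x y, J y -> J (x * y)) ->
  (forall i j, (i < j < m)%N -> J (E (lo i) (lo j))) ->
  (forall i, (i < m)%N -> a != lo i) ->
  (i < m)%N -> (p < q < m)%N -> J (E (lo p) (lo q) * lowering E lo m i a).
Proof.
move=> Egl lo_inj JB JM JE a_hi im pqm.
pose rv j := (m - j.+1)%N.
have Egl' := gl_relations_opp_transpose Egl.
have rvK j : (j < m)%N -> rv (rv j) = j by rewrite /rv; lia.
have rm : (rv i < m)%N by rewrite /rv; lia.
have lo'_inj j k : (j < m)%N -> (k < m)%N -> (lo \o rv) j = (lo \o rv) k -> j = k.
  by rewrite /= => jm km /lo_inj; rewrite /rv; lia.
have JE' j k : (j < k < m)%N -> J (- E ((lo \o rv) k) ((lo \o rv) j)).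
  by move=> jkm; rewrite -mulN1r; apply/JM/JE; rewrite /rv; lia.
have a_hi' j : (j < m)%N -> a != (lo \o rv) j by move=> jm; apply: a_hi; rewrite /rv; lia.
have qp : (rv q < rv p < m)%N by rewrite /rv; lia.
have := raising_annihilated Egl' lo'_inj JB JM JE' a_hi' rm qp.
rewrite (raising_dual E lo (Ordinal rm)); set k := (nat_of_ord (Ordinal rm)).+1.
have -> : (m - k)%N = i by exact: rvK.
have -> : (lo \o rv) (rv p) = lo p by rewrite /= rvK //; lia.
have -> : (lo \o rv) (rv q) = lo q by rewrite /= rvK //; lia.
rewrite (mulrA (- _)) (commr_sign _ k) -mulrA => /(JM ((-1) ^+ k)).
by rewrite signrMK => /(JM (-1)); rewrite mulN1r mulNr opprK.
Qed.

(** * Laurent series *)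

Lemma conv_irange (R : pzRingType) (f g : laurent R) k : exists s : seq int,
  uniq s /\ forall i, i \notin s -> lcoef f i = 0 \/ lcoef g (k - i) = 0.
Proof.
have [a fa] := lcoef_bound f; have [b gb] := lcoef_bound g.
exists (irange a (absz (a + b - k)%R).+1); split; first exact: irange_uniq.
move=> i; rewrite mem_irange => iS.
have [ai|ia] := boolP (a < i); first by left; apply: fa.
by right; apply: gb; lia.
Qed.

Section LmapMorphism.
Variables (R S : pzRingType) (f : {rmorphism R -> S}).

Lemma lmap_is_zmod_morphism : zmod_morphism (lmap f).
Proof. by move=> p q; apply: laurentP => k /=; rewrite rmorphB. Qed.

Lemma lmap_is_monoid_morphism : monoid_morphism (lmap f).
Proof.
split=> [|p q]; apply: laurentP => k /=.
  by case: ifP; rewrite ?rmorph1 ?rmorph0.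
have [s [us s0]] := conv_irange p q k.
rewrite !(@convE _ _ _ _ s) //=.
- by rewrite rmorph_sum; apply: eq_bigr => i _; rewrite rmorphM.
- by move=> i /s0[] ->; rewrite rmorph0 ?mul0r ?mulr0.
- by move=> i /s0[] ->; rewrite ?mul0r ?mulr0.
Qed.

HB.instance Definition _ :=
  GRing.isZmodMorphism.Build (laurent R) (laurent S) (lmap f) lmap_is_zmod_morphism.
HB.instance Definition _ :=
  GRing.isMonoidMorphism.Build (laurent R) (laurent S) (lmap f) lmap_is_monoid_morphism.

Lemma lmap_lconst c : lmap f (lconst c) = lconst (f c).
Proof. by apply: laurentP => k /=; case: ifP => _ //; exact: rmorph0. Qed.

Lemma lmap_lvar : lmap f 'u = 'u.
Proof. by apply: laurentP => k /=; rewrite rmorph_nat. Qed.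

End LmapMorphism.

Section LaurentFacts.
Variable R : pzRingType.

Lemma lconst_is_zmod_morphism : zmod_morphism (@lconst R).
Proof. by move=> x y; apply: laurentP => k /=; case: ifP; rewrite ?subrr. Qed.

Lemma lconst_is_monoid_morphism : monoid_morphism (@lconst R).
Proof.
by split=> // x y; apply: laurentP => k; rewrite [RHS]lcoef_const_mul /=; case: ifP; rewrite ?mulr0.
Qed.

HB.instance Definition _ :=
  GRing.isZmodMorphism.Build R (laurent R) (@lconst R) lconst_is_zmod_morphism.
HB.instance Definition _ :=
  GRing.isMonoidMorphism.Build R (laurent R) (@lconst R) lconst_is_monoid_morphism.

Lemma lcoef_lvarM (f : laurent R) k : lcoef ('u * f) k = lcoef f (k - 1).
Proof.
rewrite [LHS](@convE _ _ _ _ [:: 1]) // ?big_seq1 ?eqxx ?mul1r // => i.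
by rewrite inE /= => /negPf ->; rewrite mul0r.
Qed.

Lemma lcoef_Mlvar (f : laurent R) k : lcoef (f * 'u) k = lcoef f (k - 1).
Proof.
have e : k - (k - 1) = 1 by lia.
rewrite [LHS](@convE _ _ _ _ [:: k - 1]); first by rewrite big_seq1 /= e mulr1.
  by [].
move=> i; rewrite inE /= => ik; have -> : (k - i == 1) = false by lia.
exact: mulr0.
Qed.

Lemma lvar_central : central (lvar R).
Proof. by move=> f; apply: laurentP => k; rewrite lcoef_lvarM lcoef_Mlvar. Qed.

Lemma lvarB_nat_inv (r : nat) :
  {v : laurent R | ('u - r%:R) * v = 1 & v * ('u - r%:R) = 1}.
Proof.
(* The geometric series: the coefficient of u^-d in (u - r)^-1 is r^(d-1) for d >= 1. *)
have bd : exists N : int, forall k, N < k ->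
    (if k < 0 then (r%:R : R) ^+ (absz k).-1 else 0) = 0.
  by exists 0 => k k0; case: ifP => //; lia.
have vl : ('u - r%:R) * Laurent bd = 1.
  apply: laurentP => k; rewrite mulrBl -[LHS]/(lcoef ('u * _) k - lcoef (_ * _) k).
  rewrite lcoef_lvarM -(rmorph_nat (@lconst R)) [X in _ - X]lcoef_const_mul /=.
  have [->|k0] := eqVneq k 0; first by rewrite mulr0 subr0.
  have [kp|kn] := boolP (0 < k).
    have -> : (k - 1 < 0) = false by lia.
    have -> : (k < 0) = false by lia.
    by rewrite mulr0 subr0.
  have -> : k - 1 < 0 by lia.
  have -> : k < 0 by lia.
  have -> : (absz (k - 1)).-1 = (absz k).-1.+1 by lia.
  by rewrite exprS subrr.
exists (Laurent bd) => //; transitivity (('u - r%:R) * Laurent bd); last exact: vl.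
rewrite mulrBl mulrBr (lvar_central (Laurent bd)) (commr_nat (Laurent bd) r).
by [].
Qed.

Lemma laurent_torsion_free : torsion_free R -> torsion_free (laurent R).
Proof.
move=> Rtf n f f0; apply: laurentP => k.
have l0 : lcoef (0 : laurent R) k = 0 by rewrite /= if_same.
have cM j : lcoef (f *+ j) k = lcoef f k *+ j.
  elim: j => [|j IH]; first exact: l0.
  by rewrite !mulrS -IH.
by rewrite l0; apply: (Rtf n); rewrite -cM f0.
Qed.

End LaurentFacts.

Lemma rmorph_cdet (B B' : pzRingType) (f : {rmorphism B -> B'}) (I : eqType)
    (E : I -> I -> B) N (c d : 'I_N -> I) w :
  f (cdet E c d w) = cdet (fun x y => f (E x y)) c d (fun r => f (w r)).
Proof.
rewrite /cdet rmorph_sum; apply: eq_bigr => s _.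
rewrite rmorphM rmorph_sign rmorph_prod; congr (_ * _); apply: eq_bigr => r _.
by rewrite /Lop rmorphD rmorphMn.
Qed.

Lemma rmorph_gl_relations (B B' : pzRingType) (f : {rmorphism B -> B'}) (I : eqType)
    (E : I -> I -> B) : gl_relations E -> gl_relations (fun x y => f (E x y)).
Proof. by move=> Egl x y z t; rewrite -!rmorphM -rmorphB Egl rmorphB !rmorphMn. Qed.

Lemma Ugl_gl_relations (K : fieldType) N : gl_relations (@E K N).
Proof.
pose G (A : 'M[K]_N) : Ugl K N := pclass (@glrel K N) (Gen A).
have GD A B : G (A + B) = G A + G B.
  by rewrite -[RHS]pclassD; apply/pclassP/eqv_rel/glrelD.
have GM A B : G (A *m B - B *m A) = G A * G B - G B * G A.
  rewrite -[G A * _]pclassM -[G B * _]pclassM; transitivity (pclass (@glrel K N)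
    (Minus (Mul (Gen A) (Gen B)) (Mul (Gen B) (Gen A)))).
    exact/pclassP/eqv_rel/glrelM.
  by rewrite /Minus [LHS]pclassD; congr (_ + _); exact: pclassM.
have G0 : G 0 = 0 by apply: (addIr (G 0)); rewrite -GD !add0r.
have GN A : G (- A) = - G A by apply: (addIr (G A)); rewrite -GD !addNr.
move=> x y z t; rewrite -GM !mul_delta_mx_cond GD GN.
have Gb A (b : bool) : G (A *+ b) = G A *+ b by case: b; rewrite ?mulr0n.
by rewrite !Gb [t == x]eq_sym.
Qed.

(** * The transvector algebra *)

Section VectorRepresentation.
Variables (K : fieldType) (N : nat).

Fixpoint mx_eval (t : term K 'M[K]_N) : 'M[K]_N :=
  match t with
  | Gen A => A
  | Cst c => c%:M
  | Add s r => mx_eval s + mx_eval r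
  | Mul s r => mx_eval s *m mx_eval r
  end.

Lemma mx_eval_eqv s t : eqv (@glrel K N) s t -> mx_eval s = mx_eval t.
Proof.
elim=> //= {s t}.
- by move=> _ _ [A B|c A|A B] //=; rewrite ?mul_scalar_mx ?scaleN1r.
- by move=> s t r _ -> _ ->.
- by move=> s s' t t' _ -> _ ->.
- by move=> s s' t t' _ -> _ ->.
- by move=> *; rewrite addrA.
- by move=> *; rewrite addrC.
- by move=> s; rewrite raddf0 add0r.
- by move=> s; rewrite mul_scalar_mx scaleN1r addNr raddf0.
- by move=> *; rewrite mulmxA.
- by move=> *; rewrite mul1mx.
- by move=> *; rewrite mulmx1.
- by move=> *; rewrite mulmxDl.
- by move=> *; rewrite mulmxDr.
- by move=> *; rewrite raddfD.
- by move=> *; rewrite scalar_mxM.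
- by move=> *; rewrite scalar_mxC.
Qed.

(** Used to see that [h_i - h_j + c] is nonzero, without the
    Poincare-Birkhoff-Witt theorem. *)
Definition vrep (x : Ugl K N) : 'M[K]_N := mx_eval (repr x).

Lemma vrep_pclass t : vrep (pclass (@glrel K N) t) = mx_eval t.
Proof. by apply: mx_eval_eqv; exact: eqv_repr. Qed.

Lemma vrepD x y : vrep (x + y) = vrep x + vrep y.
Proof. exact: vrep_pclass. Qed.

Lemma vrepZ c x : vrep (c *: x) = c *: vrep x.
Proof. by rewrite [LHS]vrep_pclass /= -/(vrep _) vrep_pclass mul_scalar_mx. Qed.

Lemma vrep1 : vrep 1 = 1%:M. Proof. exact: vrep_pclass. Qed.

Lemma vrepN x : vrep (- x) = - vrep x.
Proof. by rewrite -scaleN1r vrepZ scaleN1r. Qed.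

Lemma vrepE (i j : 'I_N) : vrep (E K i j) = delta_mx i j.
Proof. exact: vrep_pclass. Qed.

Lemma E_diff_neq0 (i j : 'I_N) c : (2 : K) != 0 -> i != j -> E K i i - E K j j + c%:A <> 0.
Proof.
move=> K2 ij /(congr1 vrep); have v0 : vrep 0 = 0.
  by rewrite -(scale0r 0) vrepZ scale0r.
rewrite vrepD vrepD vrepN vrepZ vrep1 !vrepE v0 => /matrixP e.
(* The diagonal entries at i and j are c + 1 and c - 1; both vanish only if 2 = 0. *)
have := e i i; have := e j j; rewrite !mxE !eqxx eq_sym (negPf ij) /= !mulr1n mulr1.
rewrite oppr0 addr0 sub0r => /eqP; rewrite addrC subr_eq0 => /eqP -> /eqP.
by rewrite -mulr2n (negPf K2).
Qed.

End VectorRepresentation.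

Lemma normP_gen (A : pzRingType) (I : finType) (P : pred I) (g : I -> A) x :
  (forall i, P i -> g i * x \in lideal P g) -> x \in Norm P g.
Proof.
move=> gx; apply/normP => y /lidealP[c ->]; rewrite mulr_suml; apply: rpred_sum => i Pi.
by rewrite -mulrA; apply/lidealMl/gx.
Qed.

Lemma lideal_gen (A : pzRingType) (I : finType) (P : pred I) (g : I -> A) i :
  P i -> g i \in lideal P g.
Proof.
move=> Pi; apply/lidealP; exists (fun j => (j == i)%:R).
rewrite (bigD1 i) //= eqxx mul1r big1 ?addr0 // => j /andP[_ /negPf ->].
by rewrite mul0r.
Qed.

Section TransvectorFacts.
Variables (K : fieldType) (m n : nat).
Hypothesis K0 : forall k, k.+1%:R != 0 :> K.

Local Notation A' := (A' K m n).
Local Notation lo := (@lshift m n).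
Local Notation hi := (@rshift m n).
Local Notation J := (lideal (@Jdom m) (Jgen K n)).
Local Notation NormJ := (Norm (@Jdom m) (Jgen K n)).

Lemma A'_torsion_free : torsion_free A'.
Proof.
move=> k x xk; rewrite -[x]scale1r -(mulVf (K0 k)) -scalerA scaler_nat xk scaler0.
by [].
Qed.

Lemma iota_A'_inv (x : Ugl K (m + n)) : Uh x -> x <> 0 ->
  exists2 y : A', iota_A' x * y = 1 & y * iota_A' x = 1.
Proof.
move=> Ux x0; pose s : {x : Ugl K (m + n) | Uh x /\ x <> 0} := exist _ x (conj Ux x0).
exists (pclass _ (Gen (inr s))).
  by rewrite -[LHS]pclassM; apply/pclassP/eqv_rel/(locrelVr s).
by rewrite -[LHS]pclassM; apply/pclassP/eqv_rel/(locrelVl s).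
Qed.

(** The integer z allows for the shift that h_i - h_j undergoes when some E_pq is moved past it. *)
Lemma hA_diff_inv (i j : 'I_m) (z : int) : i != j ->
  exists2 y : A', (hA K n i - hA K n j + z%:~R) * y = 1 & y * (hA K n i - hA K n j + z%:~R) = 1.
Proof.
move=> ij; pose c : K := (j%:Z - i%:Z + z)%:~R.
pose x := E K (lo i) (lo i) - E K (lo j) (lo j) + c%:A.
have -> : hA K n i - hA K n j + z%:~R = iota_A' x.
  rewrite /x !rmorphD rmorphN /= /hA.
  have -> : iota_A' (m := m) (n := n) c%:A = j%:R - i%:R + z%:~R.
    by rewrite /c scaler_int rmorph_int !rmorphD rmorphN.
  non_commutative_ring.
apply: iota_A'_inv; last by apply: E_diff_neq0; [exact: (K0 1)|rewrite (inj_eq (@lshift_inj _ _))].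
have UN y : Uh y -> Uh (- y).
  by move=> Uy; rewrite -scaleN1r -mulr_algl; apply: Uh_mul Uy; exact: Uh_scal.
apply: Uh_add; last exact: Uh_scal; apply: Uh_add; first exact: Uh_E.
by apply: UN; exact: Uh_E.
Qed.

End TransvectorFacts.

Lemma prod_central_mul (B : pzRingType) (T : Type) (w : seq T) (z F : T -> B) :
  (forall i, central (z i)) ->
  (\prod_(i <- w) z i) * (\prod_(i <- w) F i) = \prod_(i <- w) (z i * F i).
Proof.
move=> zC; elim: w => [|i w IH]; first by rewrite !big_nil mulr1.
have e : (\prod_(j <- w) z j) * F i = F i * \prod_(j <- w) z j.
  by symmetry; apply/commr_prod => j _; apply/commr_sym/zC.
by rewrite !big_cons -IH !mulrA -[_ * _ * F i]mulrA e !mulrA.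
Qed.

(** * Operators and weights in A' as elements of the normalizer *)

Section TransvectorElements.
Variables (K : fieldType) (m n : nat) (i0 : 'I_m).
Hypothesis K0 : forall k, k.+1%:R != 0 :> K.

Local Notation A' := (A' K m n).
Local Notation hi := (@rshift m n).
Local Notation J := (lideal (@Jdom m) (Jgen K n)).
Local Notation NormJ := (Norm (@Jdom m) (Jgen K n)).
Local Notation Ea := (@Ea K m n).

(** A total function is needed for chains over natural numbers; [i0] is a dummy value for i >= m,
    where injectivity is not claimed. *)
Definition lo_nat (i : nat) : 'I_(m + n) := lshift n (insubd i0 i).

Lemma lo_natE (i : 'I_m) : lo_nat i = lshift n i.
Proof. by rewrite /lo_nat valKd. Qed.

Lemma lo_nat_inj i j : (i < m)%N -> (j < m)%N -> lo_nat i = lo_nat j -> i = j.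
Proof.
move=> im jm; rewrite -[ i ]/(val (Ordinal im)) -[j]/(val (Ordinal jm)) !lo_natE.
by move=> /lshift_inj ->.
Qed.

Lemma hi_lo_nat a i : hi a != lo_nat i.
Proof. by rewrite eq_rlshift. Qed.

Lemma Ea_gl_relations : gl_relations Ea.
Proof.
have := rmorph_gl_relations (@iota_A' K m n : {rmorphism Ugl K (m + n) -> A'})
  (@Ugl_gl_relations K (m + n)).
by [].
Qed.

Lemma hwt_hA (i : 'I_m) : hwt Ea lo_nat i = hA K n i.
Proof. by rewrite /hwt lo_natE. Qed.

Lemma up_path_prod (x : 'I_m) l b :
  up_path K x l b = path_prod lo_nat (transp Ea) (lo_nat x) (map val l) (hi b).
Proof. by elim: l x => [|p l IH] x /=; rewrite ?IH /transp !lo_natE. Qed.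

Lemma down_path_prod (x : 'I_m) l a :
  down_path K x l a = path_prod lo_nat Ea (lo_nat x) (map val l) (hi a).
Proof. by elim: l x => [|p l IH] x /=; rewrite ?IH !lo_natE. Qed.

Lemma raiseA_raising (i : 'I_m) b : raiseA K i b = raising Ea lo_nat i (hi b).
Proof.
pose w : seq 'I_m := rev [seq j : 'I_m <- enum 'I_m | (j < i)%N].
have ew : map val w = rev (iota 0 i).
  rewrite map_rev; congr rev; rewrite -(filter_map val (fun j => j < i)%N) val_enum_ord.
  have -> : iota 0 m = iota 0 i ++ iota i (m - i).
    by rewrite -(iotaD 0 i) subnKC // ltnW.
  rewrite filter_cat.
  rewrite (all_filterP _); last by apply/allP => j; rewrite mem_iota.
  rewrite (eq_in_filter (a2 := pred0)) ?filter_pred0 ?cats0 // => j.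
  by rewrite mem_iota => /andP[ij _]; rewrite /= ltnNge ij.
rewrite /raising -ew -sum_path_chain; last by rewrite rev_uniq filter_uniq ?enum_uniq.
have wE : [set j in w] = [set j : 'I_m | (j < i)%N].
  by apply/setP => j; rewrite !inE mem_rev mem_filter mem_enum andbT.
apply: eq_big => [L|L]; first by rewrite wE.
move=> Li; congr (_ * _).
  have -> : [seq j <- w | j \in L] = rev (enum L).
    rewrite /w filter_rev -filter_predI {2}/enum_mem -enumT; congr rev.
    apply: eq_filter => j /=; apply: andb_idr => jL.
    by have := subsetP Li _ jL; rewrite inE.
  exact: up_path_prod.
rewrite /w revK big_filter_cond /index_enum -enumT; apply: eq_bigr => j _.
by rewrite !hwt_hA.
Qed.

Lemma hA_diff_comm (i j k : 'I_m) :
  GRing.comm (hA K n i - hA K n j) (hA K n i - hA K n k).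
Proof.
rewrite -!hwt_hA; apply: (hwt_diff_comm Ea_gl_relations lo_nat_inj); exact: ltn_ord.
Qed.

Lemma lowerA_lowering (i : 'I_m) a : lowerA K a i = lowering Ea lo_nat m i (hi a).
Proof.
pose w : seq 'I_m := [seq j : 'I_m <- enum 'I_m | (i < j)%N].
have ew : map val w = iota i.+1 (m - i.+1).
  rewrite -(filter_map val (fun j => i < j)%N) val_enum_ord.
  have -> : iota 0 m = iota 0 i.+1 ++ iota i.+1 (m - i.+1).
    by rewrite -(iotaD 0 i.+1) subnKC.
  rewrite filter_cat.
  rewrite (eq_in_filter (a2 := pred0)) ?filter_pred0 => [|j]; last first.
    by rewrite mem_iota => /= ji; rewrite ltnNge -ltnS ji.
  by rewrite cat0s (all_filterP _) //; apply/allP => j; rewrite mem_iota => /andP[].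
rewrite /lowering -ew -sum_path_chain; last by rewrite filter_uniq ?enum_uniq.
have wE : [set j in w] = [set j : 'I_m | (i < j)%N].
  by apply/setP => j; rewrite !inE mem_filter mem_enum andbT.
apply: eq_big => [L|L]; first by rewrite wE.
move=> Li; congr (_ * _).
  have -> : [seq j <- w | j \in L] = enum L.
    rewrite /w -filter_predI {2}/enum_mem -enumT.
    apply: eq_filter => j /=; apply: andb_idr => jL.
    by have := subsetP Li _ jL; rewrite inE.
  exact: down_path_prod.
(* Here the chain multiplies the differences in decreasing order of j, while [lowerA] uses
   increasing order; for [raiseA] the orders agree. *)
rewrite prod_rev_comm => [|j k _ _]; last by rewrite !hwt_hA; exact: hA_diff_comm.
rewrite /w big_filter_cond /index_enum -enumT; apply: eq_bigr => j _.
by rewrite !hwt_hA.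
Qed.

Lemma JE i j : (i < j < m)%N -> Ea (lo_nat i) (lo_nat j) \in J.
Proof.
move=> /andP[ij jm]; have im := ltn_trans ij jm.
rewrite -[ i ]/(val (Ordinal im)) -[j]/(val (Ordinal jm)) !lo_natE.
exact: (lideal_gen (Jgen K n) (i := (Ordinal im, Ordinal jm))).
Qed.

Lemma Norm_lo_nat x :
  (forall p q, (p < q < m)%N -> Ea (lo_nat p) (lo_nat q) * x \in J) -> x \in NormJ.
Proof.
move=> Jx; apply: normP_gen => -[p q]; rewrite /Jdom /Jgen /= => pq.
by rewrite -!lo_natE; apply: Jx; rewrite pq ltn_ord.
Qed.

Lemma raiseA_Norm i b : raiseA K i b \in NormJ.
Proof.
rewrite raiseA_raising; apply: Norm_lo_nat => p q pq.
apply: (raising_annihilated Ea_gl_relations lo_nat_inj (J := fun x => x \in J)) => //.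
- by move=> x y; exact: rpredB.
- by move=> x y; exact: lidealMl.
- exact: JE.
- by move=> k _; exact: hi_lo_nat.
Qed.

Lemma lowerA_Norm i a : lowerA K a i \in NormJ.
Proof.
rewrite lowerA_lowering; apply: Norm_lo_nat => p q pq.
apply: (lowering_annihilated Ea_gl_relations lo_nat_inj (J := fun x => x \in J)) => //.
- by move=> x y; exact: rpredB.
- by move=> x y; exact: lidealMl.
- exact: JE.
- by move=> k _; exact: hi_lo_nat.
Qed.

Lemma Ea_hi_Norm a b : Ea (hi a) (hi b) \in NormJ.
Proof.
apply: Norm_lo_nat => p q pq; have -> : Ea (lo_nat p) (lo_nat q) * Ea (hi a) (hi b) =
  Ea (hi a) (hi b) * Ea (lo_nat p) (lo_nat q).
  by apply: (E_comm Ea_gl_relations); rewrite 1?eq_sym hi_lo_nat.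
by apply: lidealMl; exact: JE.
Qed.

Lemma Ea_hA p q (i : 'I_m) : (p < q < m)%N ->
  Ea (lo_nat p) (lo_nat q) * hA K n i =
  (hA K n i + ((i == q :> nat)%:Z - (i == p :> nat)%:Z)%:~R) * Ea (lo_nat p) (lo_nat q).
Proof.
move=> /andP[pq qm]; rewrite -hwt_hA; have pm := ltn_trans pq qm.
have pq' : lo_nat p != lo_nat q by rewrite (lo_eq lo_nat_inj) // ltn_eqF.
have [->|ip] := eqVneq (i : nat) p.
  rewrite ltn_eqF // (_ : _%:~R = -1 :> A') // mulrDl mulN1r.
  by rewrite (hwt_mulEl Ea_gl_relations) 1?eq_sym // [_ * (_ + 1)]mulrDr mulr1 addrK.
have [->|iq] := eqVneq (i : nat) q.
  rewrite (_ : _%:~R = 1 :> A') // mulrDl mul1r.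
  by rewrite (hwt_mulEr Ea_gl_relations) // [_ * (_ - 1)]mulrBr mulr1 subrK.
rewrite subrr addr0; symmetry; apply: (hwt_comm_E Ea_gl_relations).
  by rewrite (lo_eq lo_nat_inj) ?ltn_ord // eq_sym.
by rewrite (lo_eq lo_nat_inj) ?ltn_ord // eq_sym.
Qed.

Lemma hA_Norm i : hA K n i \in NormJ.
Proof.
by apply: Norm_lo_nat => p q pq; rewrite Ea_hA //; apply: lidealMl; exact: JE.
Qed.

Lemma rinv_hA_diff (i j : 'I_m) : i != j ->
  (hA K n i - hA K n j) * rinv (hA K n i - hA K n j) = 1 /\
  rinv (hA K n i - hA K n j) * (hA K n i - hA K n j) = 1.
Proof.
move=> ij; have [y] := hA_diff_inv n K0 0 ij; rewrite mulr0z addr0 => yr yl.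
by rewrite (rinvE yr yl).
Qed.

Lemma rinv_hA_diff_Norm (i j : 'I_m) : i != j -> rinv (hA K n i - hA K n j) \in NormJ.
Proof.
move=> ij; apply: Norm_lo_nat => p q pq; have [gr gl] := rinv_hA_diff ij.
set e := Ea _ _; set g := rinv _ in gr gl *.
pose z (k : 'I_m) : int := (k == q :> nat)%:Z - (k == p :> nat)%:Z.
have [y yr yl] := hA_diff_inv n K0 (z i - z j) ij.
have ed : e * (hA K n i - hA K n j) = (hA K n i - hA K n j + (z i - z j)%:~R) * e.
  rewrite mulrBr !Ea_hA // -/(z i) -/(z j) -/e -mulrBl; congr (_ * _).
  by rewrite [(z i - z j)%:~R]rmorphB opprD addrACA.
(* Moving e past the inverse [g] of a difference yields the inverse [y] of the shifted
   difference. *)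
have -> : e * g = y * e.
  by rewrite -[e * g]mul1r -yl -!mulrA (mulrA _ e g) -ed -mulrA gr mulr1.
by apply: lidealMl; exact: JE.
Qed.

End TransvectorElements.

Lemma rmorph_chain (B B' : pzRingType) (f : {rmorphism B -> B'}) (I : eqType)
    (lo : nat -> I) (E : I -> I -> B) y x w z :
  f (chain lo E y x w z) = chain lo (fun s t => f (E s t)) (f \o y) x w z.
Proof. by elim: w x => //= p w IH x; rewrite rmorphD !rmorphM !IH. Qed.

(** The common shape of both right-hand sides; it is transported along the inclusion of the
    normalizer into A' and along the projection to Z. *)
Definition lagrange_form (R : pzRingType) m (D : laurent R) (F : 'I_m -> laurent R)
    (c : 'I_m -> R) (g : 'I_m -> 'I_m -> R) : laurent R :=
  D * \prod_(i < m) F i -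
  \sum_(i < m) lconst (c i) * \prod_(j < m | j != i) (F j * lconst (g i j)).

Lemma lmap_lagrange_form (R S : pzRingType) (f : {rmorphism R -> S}) m D F c g :
  lmap f (@lagrange_form R m D F c g) =
  lagrange_form (lmap f D) (fun i => lmap f (F i)) (fun i => f (c i)) (fun i j => f (g i j)).
Proof.
rewrite rmorphB rmorphM rmorph_prod rmorph_sum; congr (_ - _).
apply: eq_bigr => i _; rewrite rmorphM rmorph_prod /= lmap_lconst; congr (_ * _).
by apply: eq_bigr => j _; rewrite rmorphM /= lmap_lconst.
Qed.

Lemma eq_lagrange_form (R : pzRingType) m D (F F' : 'I_m -> laurent R) c c' g g' :
  F =1 F' -> c =1 c' -> (forall i j, j != i -> g i j = g' i j) ->
  lagrange_form D F c g = lagrange_form D F' c' g'.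
Proof.
move=> eF ec eg; rewrite /lagrange_form; congr (_ * _ - _); first exact: eq_bigr.
apply: eq_bigr => i _; rewrite ec; congr (_ * _).
by apply: eq_bigr => j ji; rewrite eF eg.
Qed.

Lemma lmap_lower_raise_form (R S : pzRingType) (f : {rmorphism R -> S}) m (d t : nat)
    e (h l r : 'I_m -> R) g :
  lmap f (lagrange_form (d%:R * ('u - t%:R) + lconst e) (fun i => 'u + lconst (h i))
    (fun i => l i * r i) g) =
  lagrange_form (d%:R * ('u - t%:R) + lconst (f e)) (fun i => 'u + lconst (f (h i)))
    (fun i => f (l i) * f (r i)) (fun i j => f (g i j)).
Proof.
rewrite lmap_lagrange_form rmorphD rmorphM rmorphB !rmorph_nat /= lmap_lvar lmap_lconst.
apply: eq_lagrange_form => // i; last exact: rmorphM.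
by rewrite rmorphD /= lmap_lvar lmap_lconst.
Qed.

Lemma lmap_raise_lower_form (R S : pzRingType) (f : {rmorphism R -> S}) m (d : nat)
    e (h l r : 'I_m -> R) g :
  lmap f (lagrange_form (d%:R * 'u + lconst e) (fun i => 'u + lconst (h i) - 1)
    (fun i => l i * r i) g) =
  lagrange_form (d%:R * 'u + lconst (f e)) (fun i => 'u + lconst (f (h i)) - 1)
    (fun i => f (l i) * f (r i)) (fun i j => f (g i j)).
Proof.
rewrite lmap_lagrange_form rmorphD rmorphM rmorph_nat /= lmap_lvar lmap_lconst.
apply: eq_lagrange_form => // i; last exact: rmorphM.
by rewrite rmorphB rmorphD rmorph1 /= lmap_lvar lmap_lconst.
Qed.

(** * The formulas for Laurent series over A', modulo J *)

Section Transfer.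
Variables (K : fieldType) (m n : nat) (i0 : 'I_m).
Hypothesis K0 : forall k, k.+1%:R != 0 :> K.

Local Notation A' := (A' K m n).
Local Notation hi := (@rshift m n).
Local Notation J := (lideal (@Jdom m) (Jgen K n)).
Local Notation NormJ := (Norm (@Jdom m) (Jgen K n)).
Local Notation normJ := (normT (@Jdom m) (Jgen K n)).
Local Notation Ea := (@Ea K m n).
Local Notation lo := (@lo_nat m n i0).

Definition lift_norm (x : A') : normJ := insubd (0 : normJ) x.

Lemma val_lift_norm x : x \in NormJ -> val (lift_norm x) = x.
Proof. exact: insubdK. Qed.

Lemma cidx_rho (a : 'I_n) (r : 'I_m.+1) : cidx a r = rho lo m (hi a) r.
Proof.
rewrite /cidx /rho; case: (unliftP ord_max r) => [i|] ->; last by rewrite ltnn.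
by rewrite lift_max ltn_ord lo_natE.
Qed.

Lemma prod_qdetC (a b : 'I_n) :
  \prod_(k < m.+1) ('u - k%:R) * qdetC a b =
  cdet (fun x y => lconst (E K x y)) (fun r : 'I_m.+1 => rho lo m (hi a) r)
    (fun r => rho lo m (hi b) r) (fun r => 'u - r%:R).
Proof.
have zC (r : 'I_m.+1) : central ('u - r%:R : laurent (Ugl K (m + n))).
  move=> x; apply/commr_sym/commrB; first exact/commr_sym/lvar_central.
  exact: commr_nat.
rewrite mulr_sumr; apply: eq_bigr => s _.
rewrite mulrA (commr_sign _ s) -mulrA prod_central_mul //; congr (_ * _).
apply: eq_bigr => r _; have [v vr vl] := lvarB_nat_inv (Ugl K (m + n)) r.
rewrite -!cidx_rho (rinvE vr vl) /Lop mulrDr mulr_natr addrC; congr (_ + _).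
by rewrite mulrA (zC r) -mulrA vr mulr1.
Qed.

(** A left ideal of Laurent series that takes the place of the abstract [J], so that a congruence of
    series is a congruence modulo J in each coefficient. *)
Definition Jseries (f : laurent A') := forall k, lcoef f k \in J.

Lemma Jseries0 : Jseries 0.
Proof. by move=> k /=; rewrite if_same rpred0. Qed.

Lemma JseriesB f g : Jseries f -> Jseries g -> Jseries (f - g).
Proof. by move=> Jf Jg k; apply: rpredB. Qed.

Lemma JseriesM f g : Jseries g -> Jseries (f * g).
Proof.
move=> Jg k; have [s [us s0]] := conv_irange f g k.
rewrite [lcoef _ _](@convE _ _ _ _ s) //; last first.
  by move=> i /s0[] ->; rewrite ?mul0r ?mulr0.
by apply: rpred_sum => i _; apply: lidealMl.
Qed.

Local Notation lE := (fun x y => lconst (Ea x y)).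

Lemma lE_gl_relations : gl_relations lE.
Proof. exact/(rmorph_gl_relations (@lconst A'))/Ea_gl_relations. Qed.

Lemma Jseries_E i j : (i < j < m)%N -> Jseries (lE (lo i) (lo j)).
Proof. by move=> ij k /=; case: ifP => _; [exact: JE|exact: rpred0]. Qed.

Lemma hwt_lE (i : 'I_m) : hwt lE lo i = lconst (hA K n i).
Proof. by rewrite -(hwt_hA K n i0) /hwt rmorphB rmorph_nat. Qed.

Lemma hwt_lE_nat i : hwt lE lo i = lconst (hwt Ea lo i).
Proof. by rewrite /hwt rmorphB rmorph_nat. Qed.

Lemma raising_lE (i : 'I_m) b : raising lE lo i (hi b) = lconst (raiseA K i b).
Proof.
rewrite (raiseA_raising K i0) /raising rmorph_chain; apply: eq_chain => j _ /=.
by rewrite !hwt_lE_nat -rmorphB.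
Qed.

Lemma lowering_lE (i : 'I_m) a : lowering lE lo m i (hi a) = lconst (lowerA K a i).
Proof.
rewrite (lowerA_lowering K i0) /lowering rmorph_chain; apply: eq_chain => j _ /=.
by rewrite !hwt_lE_nat -rmorphB.
Qed.

Local Notation lg := (fun i j : 'I_m => lconst (rinv (hA K n i - hA K n j))).

Lemma hdiff_invr (i j : 'I_m) : i != j -> (hwt lE lo i - hwt lE lo j) * lg i j = 1.
Proof.
by move=> ij; rewrite !hwt_lE -rmorphB -rmorphM (rinv_hA_diff n K0 ij).1 rmorph1.
Qed.

Lemma hdiff_invl (i j : 'I_m) : i != j -> lg i j * (hwt lE lo i - hwt lE lo j) = 1.
Proof.
by move=> ij; rewrite !hwt_lE -rmorphB -rmorphM (rinv_hA_diff n K0 ij).2 rmorph1.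
Qed.

Lemma lmap_qminor (a b : 'I_n) :
  lmap (@iota_A' K m n) (\prod_(k < m.+1) ('u - k%:R) * qdetC a b) =
  qminor lE lo m 'u (hi a) (hi b).
Proof.
rewrite prod_qdetC.
pose f : {rmorphism laurent (Ugl K (m + n)) -> laurent A'} :=
  lmap (@iota_A' K m n : {rmorphism Ugl K (m + n) -> A'}).
rewrite -[LHS]/(f _) (rmorph_cdet f) /qminor.
set E1 := fun x y => f _; set w1 := fun r : 'I_m.+1 => f _.
have -> : E1 = lE by apply: boolp.funext => x; apply: boolp.funext => y; exact: lmap_lconst.
have -> : w1 = fun r : 'I_m.+1 => 'u - r%:R.
  by apply: boolp.funext => r; rewrite /w1 rmorphB rmorph_nat; congr (_ - _); exact: lmap_lvar.
by [].
Qed.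

Lemma delta_hi (x : laurent A') (a b : 'I_n) : x *+ (hi a == hi b) = (a == b)%:R * x.
Proof. by rewrite (inj_eq (@rshift_inj _ _)) mulr_natl. Qed.

Lemma qdetC_lower_raise (a b : 'I_n) :
  Jseries (lmap (@iota_A' K m n) (\prod_(k < m.+1) ('u - k%:R) * qdetC a b) -
    lagrange_form ((a == b)%:R * ('u - m%:R) + lconst (Ea (hi a) (hi b)))
      (fun i => 'u + lconst (hA K n i)) (fun i => lowerA K a i * raiseA K i b)
      (fun i j => rinv (hA K n i - hA K n j))).
Proof.
rewrite lmap_qminor.
have := qminor_lower_raise (laurent_torsion_free (A'_torsion_free (m := m) (n := n) K0))
  lE_gl_relations (@lo_nat_inj m n i0) Jseries0 JseriesB JseriesM Jseries_E (@lvar_central A')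
  (fun i _ => hi_lo_nat i0 a i) (fun i _ => hi_lo_nat i0 b i) hdiff_invr hdiff_invl.
congr (Jseries (_ - _)); rewrite delta_hi; congr (_ * _ - _).
  by apply: eq_bigr => i _; rewrite hwt_lE.
apply: eq_bigr => i _; rewrite lowering_lE raising_lE -rmorphM; congr (_ * _).
by apply: eq_bigr => j _; rewrite hwt_lE.
Qed.

Lemma qdetC_raise_lower (a b : 'I_n) :
  Jseries (lmap (@iota_A' K m n) (\prod_(k < m.+1) ('u - k%:R) * qdetC a b) -
    lagrange_form ((a == b)%:R * 'u + lconst (Ea (hi a) (hi b)))
      (fun i => 'u + lconst (hA K n i) - 1) (fun i => raiseA K i b * lowerA K a i)
      (fun i j => rinv (hA K n i - hA K n j))).
Proof.
rewrite lmap_qminor.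
have := qminor_raise_lower (laurent_torsion_free (A'_torsion_free (m := m) (n := n) K0))
  lE_gl_relations (@lo_nat_inj m n i0) Jseries0 JseriesB JseriesM Jseries_E (@lvar_central A')
  (fun i _ => hi_lo_nat i0 a i) (fun i _ => hi_lo_nat i0 b i) hdiff_invr hdiff_invl.
congr (Jseries (_ - _)); rewrite delta_hi; congr (_ * _ - _).
  by apply: eq_bigr => i _; rewrite hwt_lE.
apply: eq_bigr => i _; rewrite lowering_lE raising_lE -rmorphM; congr (_ * _).
by apply: eq_bigr => j _; rewrite hwt_lE.
Qed.

End Transfer.

Theorem theorem3p1 (R : realType) (m n : nat) (m_ge1 : (1 <= m)%N)
    (n_ge1 : (1 <= n)%N)
    (phi : {lrmorphism yangian R[i] n -> Ucent R[i] m n})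
    (phiE : forall a b : 'I_n,
       lmap (val \o phi : {additive yangian R[i] n -> Ugl R[i] (m + n)})
         (tser a b) = qdetC a b) :
  let psi : {rmorphism yangian R[i] n -> Z R[i] m n} := @nu R[i] m n \o phi in
  forall a b : 'I_n,
    lmap psi (Tser m a b) =
      ((a == b)%:R * ('u - m%:R) + lconst (EZ a b)) *
        \prod_(i < m) ('u + lconst (hZ i)) -
      \sum_(i < m) lconst (lower a i * raise i b) *
        \prod_(j < m | j != i) (('u + lconst (hZ j)) * lconst (hdiffV i j))
    /\
    lmap psi (Tser m a b) =
      ((a == b)%:R * 'u + lconst (EZ a b)) *
        \prod_(i < m) ('u + lconst (hZ i) - 1) -
      \sum_(i < m) lconst (raise i b * lower a i) *
        \prod_(j < m | j != i) (('u + lconst (hZ j) - 1) * lconst (hdiffV i j)).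
Proof.
move=> psi a b; pose i0 : 'I_m := Ordinal m_ge1.
have K0 k : k.+1%:R != 0 :> R[i] by rewrite Num.Theory.pnatr_eq0.
pose N := @lift_norm R[i] m n; pose pi := @nq_pi _ _ (@Jdom m) (Jgen R[i] n).
pose f : {rmorphism yangian R[i] n -> Ugl R[i] (m + n)} := val \o phi.
have fT : lmap f (Tser m a b) = \prod_(k < m.+1) ('u - k%:R) * qdetC a b.
  rewrite -phiE rmorphM rmorph_prod; congr (_ * _).
  by apply: eq_bigr => k _; rewrite rmorphB rmorph_nat; congr (_ - _); exact: lmap_lvar.
(* Equality in Z is tested in A': lift the right-hand side to a series over the normalizer and
   compare coefficients modulo J. *)
have psi_pi (y : laurent (normT (@Jdom m) (Jgen R[i] n))) :
    Jseries (lmap (@iota_A' R[i] m n) (lmap f (Tser m a b)) - lmap val y) ->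
    lmap psi (Tser m a b) = lmap pi y.
  move=> Jy; apply: laurentP => k; apply/nq_piP.
  rewrite unfold_in rmorphB; exact: Jy.
(* Only i different from j is claimed, as the factor j = i is absent from the products. *)
have Ng (i j : 'I_m) : j != i -> val (N (rinv (hA R[i] n i - hA R[i] n j))) =
    rinv (hA R[i] n i - hA R[i] n j).
  by move=> ji; apply: val_lift_norm; apply: rinv_hA_diff_Norm; rewrite // eq_sym.
have Nh i : val (N (hA R[i] n i)) = hA R[i] n i by exact/val_lift_norm/hA_Norm.
have NE : val (N (Ea R[i] (rshift m a) (rshift m b))) = Ea R[i] (rshift m a) (rshift m b).
  exact/val_lift_norm/Ea_hi_Norm.
have Nr i : val (N (raiseA R[i] i b)) = raiseA R[i] i b by exact/val_lift_norm/raiseA_Norm.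
have Nl i : val (N (lowerA R[i] a i)) = lowerA R[i] a i by exact/val_lift_norm/lowerA_Norm.
split.
- pose y := lagrange_form ((a == b)%:R * ('u - m%:R) + lconst (N (Ea R[i] (rshift m a) (rshift m b))))
    (fun i => 'u + lconst (N (hA R[i] n i))) (fun i => N (lowerA R[i] a i) * N (raiseA R[i] i b))
    (fun i j => N (rinv (hA R[i] n i - hA R[i] n j))).
  rewrite (psi_pi y); first exact: lmap_lower_raise_form.
  rewrite fT; have := qdetC_lower_raise i0 K0 a b; congr (Jseries (_ - _)).
  rewrite lmap_lower_raise_form /= NE; apply: eq_lagrange_form => [i|i|i j ji].
  + by rewrite Nh.
  + by rewrite Nl Nr.
  + by rewrite Ng.
- pose y := lagrange_form ((a == b)%:R * 'u + lconst (N (Ea R[i] (rshift m a) (rshift m b))))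
    (fun i => 'u + lconst (N (hA R[i] n i)) - 1) (fun i => N (raiseA R[i] i b) * N (lowerA R[i] a i))
    (fun i j => N (rinv (hA R[i] n i - hA R[i] n j))).
  rewrite (psi_pi y); first exact: lmap_raise_lower_form.
  rewrite fT; have := qdetC_raise_lower i0 K0 a b; congr (Jseries (_ - _)).
  rewrite lmap_raise_lower_form /= NE; apply: eq_lagrange_form => [i|i|i j ji].
  + by rewrite Nh.
  + by rewrite Nl Nr.
  + by rewrite Ng.
Qed.
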